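(* Let $\alpha\in\mathbb{R}$ and $\beta\in\mathbb{R}\setminus\mathbb{Z}$. Let $Q(x,y)$ be an indefinite binary quadratic form with positive real coefficients and discriminant $1$, and let $0<w'<w$ be the roots of $Q(1,-x)=0$. Let $Z_Q(s;(\alpha,\beta))=\sum_{p\geq 1,\,q\geq 0}e^{2\pi i(\alpha p+\beta q)}Q(p,q)^{-s}$ for $\mathrm{Re}(s)>1$. Then for every integer $k>1$, $$Z_Q(k;(\alpha,\beta))=-(\mathscr{D}_{k-1}\mathscr{F}_{2k})(w,w';\alpha,\beta).$$
   Context: For $\alpha\in\mathbb{R}$, $\beta\in\mathbb{R}\setminus\mathbb{Z}$ and an integer $k\geq1$, the higher Herglotz–Zagier–Novikov function is $$\mathscr{F}_k(x;\alpha,\beta)=\int_0^\infty\frac{\mathrm{Li}_{k-1}(e^{-xt}e^{2\pi i\alpha})}{1-e^{-t}e^{2\pi i\beta}}\,dt,\qquad \mathrm{Re}(x)>0,$$ where $\mathrm{Li}_s(z)=\sum_{n\geq1}z^n/n^s$; for $\mathrm{Re}(x)>0$ it equals $\sum_{p\geq1,q\geq0}\frac{e^{2\pi i(\alpha p+\beta q)}}{p^{k-1}(px+q)}$. For $n\in\mathbb{N}\cup\{0\}$ and a function $f(x;\alpha,\beta)$, the operator $\mathscr{D}_n$ is $$(\mathscr{D}_nf)(x,y;\alpha,\beta)=\sum_{i=0}^n\binom{2n-i}{n}\frac{f^{(i)}(x;\alpha,\beta)-(-1)^if^{(i)}(y;\alpha,\beta)}{i!\,(y-x)^{n-i}},$$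 where $f^{(i)}$ denotes the $i$-th derivative with respect to the first variable. *)

(* Defs.v *)
From mathcomp Require Import all_boot all_order all_algebra.
From mathcomp Require Import complex.
From mathcomp Require Import all_classical all_reals all_analysis.

Set Implicit Arguments.
Unset Strict Implicit.
Unset Printing Implicit Defensive.

Import Order.TTheory GRing.Theory Num.Theory.
Import numFieldNormedType.Exports.

Local Open Scope classical_set_scope.
Local Open Scope complex_scope.
Local Open Scope ring_scope.

Definition cexp (R : realType) (z : R[i]) : R[i] :=
  (expR (complex.Re z))%:C *
    (cos (complex.Im z) +i* sin (complex.Im z)).

(* e^{2 pi i a} *)
Definition e2pi (R : realType) (a : R) : R[i] :=
  cexp (0 +i* (2 * pi * a)).

(* r^s for r > 0 and complex s; ln is a total function equal to 0 outside
   of the positive reals, so the value is meaningless for r <= 0. *)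
Definition rpowc (R : realType) (r : R) (s : R[i]) : R[i] :=
  cexp (s * (ln r)%:C).

(* The topology and normed-module structure of the complex plane are attached
   to the regular algebra R[i]^o, which is convertible to R[i]. *)
Definition csum (R : realType) (u : nat -> R[i]) : R[i] :=
  limn (series (u : nat -> R[i]^o)).

(* n-th complex derivative: derive1n over the field R[i] takes limits of
   difference quotients with complex increments. *)
Definition cderiv (R : realType) (n : nat) (f : R[i] -> R[i]) : R[i] -> R[i] :=
  derive1n n (f : R[i] -> R[i]^o).

Definition cintegral (R : realType) (D : set R) (f : R -> R[i]) : R[i] :=
  (\int[@lebesgue_measure R]_(t in D) complex.Re (f t)) +i*
  (\int[@lebesgue_measure R]_(t in D) complex.Im (f t)).

(* Li_s(z), for |z| < 1 *)
Definition polylog (R : realType) (s z : R[i]) : R[i] :=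
  csum (fun n => z ^+ n.+1 / rpowc n.+1%:R s).

(* The higher Herglotz-Zagier-Novikov function F_k(x; alpha, beta), for k >= 1,
   beta not an integer and Re x > 0. *)
Definition HZN (R : realType) (k : nat) (alpha beta : R) (x : R[i]) : R[i] :=
  cintegral `]0, +oo[
    (fun t => polylog (k%:R - 1) (cexp (- x * t%:C) * e2pi alpha) /
              (1 - cexp (- t%:C) * e2pi beta)).

(* The parameters alpha and beta of f(x; alpha, beta) are fixed by partial
   application: (D_n f)(x, y; alpha, beta) is Dop n (f alpha beta) x y. *)
Definition Dop (R : realType) (n : nat) (f : R[i] -> R[i]) (x y : R[i]) : R[i] :=
  \sum_(0 <= i < n.+1)
    'C(2 * n - i, n)%:R *
    ((cderiv i f x - (-1) ^+ i * cderiv i f y) /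
     (i`!%:R * (y - x) ^+ (n - i))).

(* qxx X^2 + qxy X Y + qyy Y^2 *)
Record bqform (R : Type) := BQForm { qxx : R; qxy : R; qyy : R }.

Definition qeval (R : realType) (Q : bqform R) (x y : R) : R :=
  qxx Q * x ^+ 2 + qxy Q * x * y + qyy Q * y ^+ 2.

Definition qdisc (R : realType) (Q : bqform R) : R :=
  qxy Q ^+ 2 - 4 * qxx Q * qyy Q.

Definition indefinite (R : realType) (Q : bqform R) : Prop :=
  (exists x y : R, 0 < qeval Q x y) /\ (exists x y : R, qeval Q x y < 0).

(* The outer index is p - 1; the double series converges absolutely for
   Re s > 1 when Q has positive coefficients. *)
Definition ZQ (R : realType) (Q : bqform R) (alpha beta : R) (s : R[i]) : R[i] :=
  csum (fun p => csum (fun q =>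
    e2pi (alpha * p.+1%:R + beta * q%:R) *
    rpowc (qeval Q p.+1%:R q%:R) (- s))).

(* Main.v *)
(* Write P for the outer index, e(x) for e^{2 pi i x}, and k = n + 1. With
   g(z) the Laplace transform of phi(t) = 1 / (1 - e^{-t} e(beta)), which is
   bounded on t > 0 because beta is not an integer, expanding the polylogarithm
   gives F_{2k}(x) = sum_P e(alpha P) P^{-(2k-1)} g(P x), and the estimates
   |g^{(i)}(z)| <= K_i / (Re z)^{i+1} allow termwise complex differentiation.
   For real c > 0 the geometric expansion of phi, with its exact remainder,
   gives g^{(i)}(c) = sum_q e(beta q) (-1)^i i! / (c + q)^{i+1}, a conditionally
   convergent series for i = 0. The operator D_{k-1} combines these, for
   c = P w and c = P w', into the partial fraction expansion of
   ((P w + q) (P w' + q))^{-k}, and the roots w, w' of a form of discriminant 1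
   satisfy Q(P, q) = (P w + q) (P w' + q) / (w - w'). *)

Require Import Defs.
From mathcomp Require Import all_boot all_order all_algebra.
From mathcomp Require Import complex.
From mathcomp Require Import all_classical all_reals all_analysis.
From mathcomp Require Import measurable_realfun.
From mathcomp Require Import ring lra zify.
Import Order.TTheory GRing.Theory Num.Theory.
Import numFieldNormedType.Exports.
Import Normc.
Local Open Scope classical_set_scope.
Local Open Scope complex_scope.
Local Open Scope ring_scope.

Set Implicit Arguments.
Unset Strict Implicit.
Unset Printing Implicit Defensive.

(** * Complex numbers, convergence and integrals *)

Section ComplexNumbers.
Variable R : realType.
Implicit Types z : R[i].

(** The function g is used in two ways that pull apart: its derivatives are taken with complex
    increments in a half-plane, while its expansion in q is available at real points only.
    Derivatives therefore come from second-order Taylor estimates of integrals, uniform enough to be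
    summed over P, and no series in q is ever differentiated. This matters because for i = 0 the
    series in q does not converge absolutely: it has no summable majorant, and sums over P and q
    cannot be freely interchanged. P stays outside and q inside, as in Z_Q, and only the finite sum
    over i is exchanged with limits. The index 2k is a matter of homogeneity: with X = P w + q and Y
    = P w' + q, the partial fraction identity carries a factor (Y - X)^(2k-1), whose P^(2k-1)
    cancels the weight P^(-(2k-1)). *)

Lemma ReD z1 z2 : complex.Re (z1 + z2) = complex.Re z1 + complex.Re z2.
Proof. by case: z1 z2 => ? ? [? ?]. Qed.

Lemma ImD z1 z2 : complex.Im (z1 + z2) = complex.Im z1 + complex.Im z2.
Proof. by case: z1 z2 => ? ? [? ?]. Qed.

Lemma ReN z : complex.Re (- z) = - complex.Re z.
Proof. by case: z. Qed.

Lemma ImN z : complex.Im (- z) = - complex.Im z.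
Proof. by case: z. Qed.

Lemma ReM z1 z2 : complex.Re (z1 * z2) =
  complex.Re z1 * complex.Re z2 - complex.Im z1 * complex.Im z2.
Proof. by case: z1 z2 => ? ? [? ?]. Qed.

Lemma ImM z1 z2 : complex.Im (z1 * z2) =
  complex.Re z1 * complex.Im z2 + complex.Im z1 * complex.Re z2.
Proof. by case: z1 z2 => ? ? [? ?]. Qed.

Lemma complex_eqP z1 z2 : complex.Re z1 = complex.Re z2 ->
  complex.Im z1 = complex.Im z2 -> z1 = z2.
Proof. by case: z1 z2 => ? ? [? ?] /= -> ->. Qed.

Lemma normc_sqr z : normc z ^+ 2 = complex.Re z ^+ 2 + complex.Im z ^+ 2.
Proof. by case: z => a b /=; rewrite sqr_sqrtr// addr_ge0// sqr_ge0. Qed.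

Lemma normc_ge0 z : 0 <= normc z.
Proof. by case: z => a b; exact: sqrtr_ge0. Qed.

Lemma normrC z : `|z| = (normc z)%:C.
Proof. by rewrite normc_def; case: z. Qed.

Lemma normc_real (x : R) : normc x%:C = `|x|.
Proof. by rewrite /= expr0n addr0 sqrtr_sqr. Qed.

Lemma normcD z1 z2 : normc (z1 + z2) <= normc z1 + normc z2.
Proof. exact: le_normcD. Qed.

Lemma normcX z n : normc (z ^+ n) = normc z ^+ n.
Proof.
elim: n => [|n ih]; first by rewrite !expr0 normc1.
by rewrite !exprS normcM ih.
Qed.

Lemma normr_Re_le z : `|complex.Re z| <= normc z.
Proof.
by rewrite -(ler_pXn2r (_ : 0 < 2)%N) ?nnegrE ?normc_ge0// normc_sqr
  real_normK ?num_real// lerDl sqr_ge0.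
Qed.

Lemma normr_Im_le z : `|complex.Im z| <= normc z.
Proof.
by rewrite -(ler_pXn2r (_ : 0 < 2)%N) ?nnegrE ?normc_ge0// normc_sqr
  real_normK ?num_real// lerDr sqr_ge0.
Qed.

Lemma normc_le_ReIm z : normc z <= `|complex.Re z| + `|complex.Im z|.
Proof.
rewrite {1}(complexE z) (le_trans (normcD _ _))// lerD// ?normcM normc_real//.
by rewrite /= expr0n expr1n add0r sqrtr1 mul1r.
Qed.

Lemma normc_sum (I : Type) (r : seq I) (P : pred I) (F : I -> R[i]) :
  normc (\sum_(i <- r | P i) F i) <= \sum_(i <- r | P i) normc (F i).
Proof.
elim/big_rec2: _ => [|i y z _ ih]; first by rewrite normc0.
by rewrite (le_trans (normcD _ _))// lerD2l.
Qed.

Lemma Re_sum (I : Type) (r : seq I) (P : pred I) (F : I -> R[i]) :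
  complex.Re (\sum_(i <- r | P i) F i) = \sum_(i <- r | P i) complex.Re (F i).
Proof. by elim/big_rec2: _ => // i y z _ <-; rewrite ReD. Qed.

Lemma Im_sum (I : Type) (r : seq I) (P : pred I) (F : I -> R[i]) :
  complex.Im (\sum_(i <- r | P i) F i) = \sum_(i <- r | P i) complex.Im (F i).
Proof. by elim/big_rec2: _ => // i y z _ <-; rewrite ImD. Qed.

Lemma cexpD z1 z2 : cexp (z1 + z2) = cexp z1 * cexp z2.
Proof.
rewrite /cexp ReD ImD expRD cosD sinD rmorphM /= mulrACA; congr (_ * _).
by apply: complex_eqP; rewrite ?ReM ?ImM /= // addrC.
Qed.

Lemma normc_cexp z : normc (cexp z) = expR (complex.Re z).
Proof.
rewrite /cexp normcM normc_real ger0_norm ?expR_ge0//=.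
by rewrite cos2Dsin2 sqrtr1 mulr1.
Qed.

Lemma cexp_real (x : R) : cexp x%:C = (expR x)%:C.
Proof. by rewrite /cexp /= cos0 sin0 mulr1. Qed.

Lemma cexp0 : cexp (0 : R[i]) = 1.
Proof. by rewrite -[0]/(0%:C) cexp_real expR0. Qed.

Lemma cexpMn z n : cexp (n%:R * z) = cexp z ^+ n.
Proof.
elim: n => [|n ih]; first by rewrite mul0r cexp0 expr0.
by rewrite exprS -ih -cexpD -add1n natrD mulrDl mul1r.
Qed.

Lemma cexp_neq0 z : cexp z != 0.
Proof.
apply/eqP => z0; have := normc_cexp z; rewrite z0 normc0.
by move/eqP; rewrite eq_sym (gt_eqF (expR_gt0 _)).
Qed.

Lemma cexpN z : cexp (- z) = (cexp z)^-1.
Proof.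
apply: (mulfI (cexp_neq0 z)).
by rewrite divff ?cexp_neq0// -cexpD subrr cexp0.
Qed.

Lemma e2piD (a b : R) : e2pi (a + b) = e2pi a * e2pi b.
Proof.
rewrite /e2pi -cexpD; congr cexp.
by apply: complex_eqP; rewrite ?ReD ?ImD /= ?addr0 ?mulrDr.
Qed.

Lemma e2piMn (a : R) n : e2pi (a * n%:R) = e2pi a ^+ n.
Proof.
elim: n => [|n ih]; first by rewrite mulr0 expr0 /e2pi mulr0 cexp0.
by rewrite exprS -ih -e2piD -add1n natrD mulrDr mulr1.
Qed.

Lemma normc_e2pi (a : R) : normc (e2pi a) = 1.
Proof. by rewrite normc_cexp expR0. Qed.

Lemma rpowc_nat (r : R) n : 0 < r -> rpowc r n%:R = (r ^+ n)%:C.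
Proof. 
move=> r0; rewrite /rpowc cexpMn cexp_real lnK ?posrE//.
by rewrite rmorphXn.
Qed.

Lemma rpowcN (r : R) z : rpowc r (- z) = (rpowc r z)^-1.
Proof. by rewrite /rpowc mulNr cexpN. Qed.

End ComplexNumbers.

(** * Limits and series in the complex plane, tested by real norms *)

Section ComplexConvergence.
Variable R : realType.
Local Notation C := (R[i]^o).

(** The norm on [R[i]^o] is complex-valued, and so are the tolerances in its limits; a positive
    tolerance in [R[i]] is real, so convergence can be tested on the real-valued [normc], where
    squeezing applies. *)
Lemma ccvgP (T : Type) (F : set_system T) {FF : Filter F} (u : T -> C) (l : C) :
  normc (u x - l) @[x --> F] --> (0 : R) -> u @ F --> l.
Proof.
move=> /cvgr0Pnorm_le ul; apply/cvgrPdist_le => e e0.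
have Re0 : 0 < complex.Re e by move: e0; rewrite ltcE => /andP[].
have [eE] : e = (complex.Re e)%:C.
  by move: e0; case: (e) => a b; rewrite ltcE/= => /andP[/eqP -> _].
near=> x; rewrite eE normrC lecR -normcN opprB.
rewrite -[leLHS]ger0_norm ?normc_ge0//.
by near: x; exact: ul.
Unshelve. all: by end_near. Qed.

Lemma ccvg_normc (T : Type) (F : set_system T) {FF : Filter F} (u : T -> C)
  (l : C) : u @ F --> l -> normc (u x - l) @[x --> F] --> (0 : R).
Proof.
move=> /cvgrPdist_le ul; apply/cvgr0Pnorm_le => e e0.
near=> x; rewrite ger0_norm ?normc_ge0// -lecR -normrC distrC.
by near: x; apply: ul; rewrite ltcR.
Unshelve. all: by end_near. Qed.

Lemma ccvg_Re (T : Type) (F : set_system T) {FF : Filter F} (u : T -> C)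
  (l : C) : u @ F --> l -> complex.Re (u x) @[x --> F] --> complex.Re l.
Proof.
move=> /ccvg_normc ul; apply/subr_cvg0/norm_cvg0P.
apply: (squeeze_cvgr _ (cvg_cst 0) ul); apply: nearW => x.
by rewrite normr_ge0 -ReN -ReD normr_Re_le.
Qed.

Lemma ccvg_Im (T : Type) (F : set_system T) {FF : Filter F} (u : T -> C)
  (l : C) : u @ F --> l -> complex.Im (u x) @[x --> F] --> complex.Im l.
Proof.
move=> /ccvg_normc ul; apply/subr_cvg0/norm_cvg0P.
apply: (squeeze_cvgr _ (cvg_cst 0) ul); apply: nearW => x.
by rewrite normr_ge0 -ImN -ImD normr_Im_le.
Qed.

Lemma ccvg_ReIm (T : Type) (F : set_system T) {FF : Filter F} (u : T -> C)
  (l : C) : complex.Re (u x) @[x --> F] --> complex.Re l ->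
  complex.Im (u x) @[x --> F] --> complex.Im l -> u @ F --> l.
Proof.
move=> uRe uIm; apply: ccvgP.
have : `|complex.Re (u x) - complex.Re l| + `|complex.Im (u x) - complex.Im l|
    @[x --> F] --> (0 : R).
  rewrite -[0]addr0; apply: cvgD; apply/norm_cvg0P; exact/subr_cvg0.
apply: squeeze_cvgr (cvg_cst 0); apply: nearW => x; rewrite normc_ge0/=.
by rewrite (le_trans (normc_le_ReIm _))// ReD ImD ReN ImN.
Qed.

Lemma csum_cvg (u : nat -> R[i]) (l : R[i]) :
  series (u : nat -> C) @ \oo --> (l : C) -> csum u = l.
Proof. exact: cvg_lim. Qed.

(** [csum] is a total limit operator, so its value means something only once convergence is known;
    here it follows by comparison for the real and imaginary parts. *)
Lemma csumable (u : nat -> R[i]) (v : nat -> R) :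
  (forall n, normc (u n) <= v n) -> cvgn (series v) -> series (u : nat -> C) @ \oo --> (csum u : C).
Proof.
move=> uv cv.
have cRe : cvgn (series (fun n => complex.Re (u n))).
  apply: normed_cvg; apply: series_le_cvg cv => n /=; rewrite ?normr_ge0//.
  - by rewrite (le_trans _ (uv n))// normc_ge0.
  - by rewrite (le_trans _ (uv n))// normr_Re_le.
have cIm : cvgn (series (fun n => complex.Im (u n))).
  apply: normed_cvg; apply: series_le_cvg cv => n /=; rewrite ?normr_ge0//.
  - by rewrite (le_trans _ (uv n))// normc_ge0.
  - by rewrite (le_trans _ (uv n))// normr_Im_le.
have cu : series (u : nat -> C) @ \oo -->
    ((limn (series (fun n => complex.Re (u n))) +i*
     limn (series (fun n => complex.Im (u n)))) : C).
  apply: ccvg_ReIm => /=.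
  - by under eq_fun do rewrite Re_sum; exact: cRe.
  - by under eq_fun do rewrite Im_sum; exact: cIm.
by rewrite (csum_cvg cu).
Qed.

Lemma normc_csum_le (u : nat -> R[i]) (v : nat -> R) :
  (forall n, normc (u n) <= v n) -> cvgn (series v) ->
  normc (csum u) <= limn (series v).
Proof.
move=> uv cv; have /ccvg_normc cu := csumable uv cv.
rewrite -[leRHS]addr0.
apply: ler_cvg_to (cvg_cst (normc (csum u))) (cvgD cv cu) _.
apply: nearW => n.
rewrite -lerBlDl (le_trans (_ : _ <= normc (csum u) - normc (series u n)))//.
  rewrite lerD2l lerN2 (le_trans (normc_sum _ _ _))//.
  by apply: ler_sum => k _.
rewrite lerBlDl -[leRHS]addrC -{1}[csum u](subrK (series (u : nat -> C) n)).
by rewrite (le_trans (normcD _ _))// -normcN opprB.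
Qed.

End ComplexConvergence.

(** * Complex-valued integrals over the positive half-line *)

Section ComplexIntegral.
Variable R : realType.
Local Notation C := (R[i]^o).
Local Notation mu := (@lebesgue_measure R).
Local Notation D := (`]0, +oo[%classic : set R).
Implicit Types (f g : R -> R[i]) (h : R -> R).

Definition cmeasurable f := measurable_fun D (fun t => complex.Re (f t)) /\
  measurable_fun D (fun t => complex.Im (f t)).

Definition cintegrable f := mu.-integrable D (fun t => (complex.Re (f t))%:E) /\
  mu.-integrable D (fun t => (complex.Im (f t))%:E).

Lemma cmeasurable_cst z : cmeasurable (fun=> z).
Proof. by split; exact: measurable_cst. Qed.

Lemma cmeasurableD f g : cmeasurable f -> cmeasurable g ->
  cmeasurable (fun t => f t + g t).
Proof.
move=> [f1 f2] [g1 g2]; split.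
  by apply: eq_measurable_fun (measurable_funD f1 g1) => t _; rewrite ReD.
by apply: eq_measurable_fun (measurable_funD f2 g2) => t _; rewrite ImD.
Qed.

Lemma cmeasurableM f g : cmeasurable f -> cmeasurable g ->
  cmeasurable (fun t => f t * g t).
Proof.
move=> [f1 f2] [g1 g2]; split.
  apply: eq_measurable_fun
    (measurable_funB (measurable_funM f1 g1) (measurable_funM f2 g2)) => t _.
  by rewrite ReM.
apply: eq_measurable_fun
  (measurable_funD (measurable_funM f1 g2) (measurable_funM f2 g1)) => t _.
by rewrite ImM.
Qed.

Lemma cmeasurableX f n : cmeasurable f -> cmeasurable (fun t => f t ^+ n).
Proof.
move=> mf; elim: n => [|n ih].
  by rewrite (_ : (fun _ => _) = fun=> 1) ?funeqE//; exact: cmeasurable_cst.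
rewrite (_ : (fun _ => _) = fun t => f t * f t ^+ n); first exact: cmeasurableM.
by apply/funext => t; rewrite exprS.
Qed.

Lemma cmeasurable_sum (I : Type) (r : seq I) (F : I -> R -> R[i]) :
  (forall i, cmeasurable (F i)) -> cmeasurable (fun t => \sum_(i <- r) F i t).
Proof.
move=> mF; elim: r => [|i r ih].
  rewrite (_ : (fun _ => _) = fun=> 0); first exact: cmeasurable_cst.
  by apply/funext => t; rewrite big_nil.
rewrite (_ : (fun _ => _) = fun t => F i t + \sum_(i <- r) F i t).
  exact: cmeasurableD.
by apply/funext => t; rewrite big_cons.
Qed.

Lemma cmeasurable_real h : measurable_fun D h -> cmeasurable (fun t => (h t)%:C).
Proof. by move=> mh; split => //=; exact: measurable_cst. Qed.

Lemma cmeasurable_id : cmeasurable (fun t => t%:C).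
Proof. by apply: cmeasurable_real; exact: measurable_id. Qed.

Lemma cmeasurable_cexp f : cmeasurable f -> cmeasurable (fun t => cexp (f t)).
Proof.
move=> [f1 f2]; rewrite /cexp; apply: cmeasurableM.
  by apply: cmeasurable_real; exact: measurableT_comp.
split => /=; apply: measurableT_comp => //; apply: continuous_measurable_fun.
- exact: continuous_cos.
- exact: continuous_sin.
Qed.

Lemma cmeasurable_cvg (F : nat -> R -> R[i]) f : (forall n, cmeasurable (F n)) ->
  (forall t, 0 < t -> F ^~ t @ \oo --> (f t : C)) -> cmeasurable f.
Proof.
move=> mF Ff; split.
- apply: (@measurable_fun_cvg _ _ _ _ (fun n t => complex.Re (F n t))).
    by move=> n; exact: (mF n).1.
  by move=> t /=; rewrite in_itv/= andbT => t0; exact: (ccvg_Re (Ff _ t0)).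
- apply: (@measurable_fun_cvg _ _ _ _ (fun n t => complex.Im (F n t))).
    by move=> n; exact: (mF n).2.
  by move=> t /=; rewrite in_itv/= andbT => t0; exact: (ccvg_Im (Ff _ t0)).
Qed.

Lemma le_cintegrable f h : cmeasurable f ->
  (forall t, 0 < t -> normc (f t) <= h t) ->
  mu.-integrable D (EFin \o h) -> cintegrable f.
Proof.
move=> [f1 f2] fh ih; split; apply: le_integrable ih => //=.
- exact/measurable_EFinP.
- move=> t /=; rewrite in_itv/= andbT => t0; rewrite lee_fin.
  by rewrite (le_trans (normr_Re_le _))// (le_trans (fh _ t0))// ler_norm.
- exact/measurable_EFinP.
- move=> t /=; rewrite in_itv/= andbT => t0; rewrite lee_fin.
  by rewrite (le_trans (normr_Im_le _))// (le_trans (fh _ t0))// ler_norm.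
Qed.

Lemma eq_cintegral f g : (forall t, 0 < t -> f t = g t) ->
  cintegral D f = cintegral D g.
Proof.
by move=> fg; congr Complex; apply: eq_Rintegral => t;
  rewrite inE/= in_itv/= andbT => t0; rewrite fg.
Qed.

Lemma cintegral0 : cintegral D (fun=> 0 : R[i]) = 0.
Proof. by rewrite /cintegral /= !Rintegral_cst//= !mul0r. Qed.

Lemma cintegrableD f g : cintegrable f -> cintegrable g ->
  cintegrable (fun t => f t + g t).
Proof.
move=> [f1 f2] [g1 g2]; split.
  by apply: eq_integrable (integrableD _ f1 g1) => // t _; rewrite /= ReD EFinD.
by apply: eq_integrable (integrableD _ f2 g2) => // t _; rewrite /= ImD EFinD.
Qed.

Lemma cintegralD f g : cintegrable f -> cintegrable g ->
  cintegral D (fun t => f t + g t) = cintegral D f + cintegral D g.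
Proof.
move=> [f1 f2] [g1 g2]; rewrite /cintegral; apply: complex_eqP => /=.
  by under eq_Rintegral do rewrite ReD; rewrite RintegralD.
by under eq_Rintegral do rewrite ImD; rewrite RintegralD.
Qed.

Lemma cintegrableZ z f : cintegrable f -> cintegrable (fun t => z * f t).
Proof.
move=> [f1 f2]; split.
  apply: eq_integrable (integrableB _ (integrableZl _ (complex.Re z) f1)
    (integrableZl _ (complex.Im z) f2)) => // t _.
  by rewrite /= ReM EFinB !EFinM.
apply: eq_integrable (integrableD _ (integrableZl _ (complex.Re z) f2)
  (integrableZl _ (complex.Im z) f1)) => // t _.
by rewrite /= ImM EFinD !EFinM.
Qed.

Lemma cintegralZ z f : cintegrable f ->
  cintegral D (fun t => z * f t) = z * cintegral D f.
Proof.
move=> [f1 f2]; rewrite /cintegral.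
have iZ (r : R) h : mu.-integrable D (EFin \o h) ->
    mu.-integrable D (EFin \o (fun t => r * h t)).
  by move=> ih; apply: eq_integrable (integrableZl _ r ih).
apply: complex_eqP.
  rewrite ReM /=; under eq_Rintegral do rewrite ReM.
  by rewrite RintegralB ?RintegralZl//; exact: iZ.
rewrite ImM /=; under eq_Rintegral do rewrite ImM.
by rewrite RintegralD ?RintegralZl//; exact: iZ.
Qed.

Lemma cintegrable_sum (I : Type) (r : seq I) (F : I -> R -> R[i]) :
  (forall i, cintegrable (F i)) -> cintegrable (fun t => \sum_(i <- r) F i t).
Proof.
move=> iF; elim: r => [|i r ih].
  rewrite (_ : (fun _ => _) = fun=> 0); first by split; exact: integrable0.
  by apply/funext => t; rewrite big_nil.
rewrite (_ : (fun _ => _) = fun t => F i t + \sum_(i <- r) F i t).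
  exact: cintegrableD.
by apply/funext => t; rewrite big_cons.
Qed.

Lemma cintegral_sum (I : Type) (r : seq I) (F : I -> R -> R[i]) :
  (forall i, cintegrable (F i)) ->
  cintegral D (fun t => \sum_(i <- r) F i t) = \sum_(i <- r) cintegral D (F i).
Proof.
move=> iF; elim: r => [|i r ih].
  rewrite big_nil -[RHS]cintegral0; apply: eq_cintegral => t _.
  by rewrite big_nil.
rewrite big_cons -ih -cintegralD//; last exact: cintegrable_sum.
by apply: eq_cintegral => t _; rewrite big_cons.
Qed.

(** The factor 2 arises because the real and imaginary parts are each estimated by the integral of
    [h]. *)
Lemma normc_cintegral_le f h : cmeasurable f ->
  (forall t, 0 < t -> normc (f t) <= h t) ->
  mu.-integrable D (EFin \o h) ->
  normc (cintegral D f) <= 2 * \int[mu]_(t in D) h t.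
Proof.
move=> mf fh ih; have [f1 f2] := le_cintegrable mf fh ih.
rewrite (le_trans (normc_le_ReIm _))//= mulr2n mulrDl mul1r lerD//.
  rewrite (le_trans (le_normr_Rintegral _ _))// le_Rintegral//.
    exact: integrable_norm.
  move=> t /=; rewrite in_itv/= andbT => t0.
  by rewrite (le_trans (normr_Re_le _))// fh.
rewrite (le_trans (le_normr_Rintegral _ _))// le_Rintegral//.
  exact: integrable_norm.
move=> t /=; rewrite in_itv/= andbT => t0.
by rewrite (le_trans (normr_Im_le _))// fh.
Qed.

Lemma cintegral_dominated_cvg (F : nat -> R -> R[i]) f h :
  (forall n, cmeasurable (F n)) ->
  (forall t, 0 < t -> F ^~ t @ \oo --> (f t : C)) ->
  (forall n t, 0 < t -> normc (F n t) <= h t) ->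
  mu.-integrable D (EFin \o h) ->
  (fun n => cintegral D (F n) : C) @ \oo --> (cintegral D f : C).
Proof.
move=> mF Ff Fh ih.
have iF n := le_cintegrable (mF n) (Fh n) ih.
(* The bound passes to the limit through normc (f t) <= normc (F n t) + normc (F n t - f t). *)
have nf t : 0 < t -> normc (f t) <= h t.
  move=> t0; rewrite -[leRHS]addr0.
  have cF : h t + normc (F n t - f t) @[n --> \oo] --> h t + 0.
    by apply: cvgD; [exact: cvg_cst|exact: ccvg_normc (Ff _ t0)].
  apply: (ler_cvg_to (cvg_cst (normc (f t))) cF); apply: nearW => n /=.
  rewrite -lerBlDr -[normc (F n t - f t)]normcN opprB.
  rewrite lerBlDr -{1}(subrK (F n t) (f t)) (le_trans (normcD _ _))// addrC.
  by rewrite lerD2r Fh.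
have [f1 f2] := le_cintegrable (cmeasurable_cvg mF Ff) nf ih.
apply: ccvg_ReIm => /=; apply: fine_cvg.
- rewrite fineK; last exact: integrable_fin_num.
  apply: (@dominated_cvg _ _ _ mu D _ _ _ (EFin \o h)) => //.
  + by move=> n; apply/measurable_EFinP; exact: (mF n).1.
  + move=> t /=; rewrite in_itv/= andbT => t0.
    by apply: cvg_EFin; [exact: nearW|exact: ccvg_Re (Ff _ t0)].
  + move=> n t /=; rewrite in_itv/= andbT => t0.
    by rewrite lee_fin (le_trans (normr_Re_le _))// Fh.
- rewrite fineK; last exact: integrable_fin_num.
  apply: (@dominated_cvg _ _ _ mu D _ _ _ (EFin \o h)) => //.
  + by move=> n; apply/measurable_EFinP; exact: (mF n).2.
  + move=> t /=; rewrite in_itv/= andbT => t0.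
    by apply: cvg_EFin; [exact: nearW|exact: ccvg_Im (Ff _ t0)].
  + move=> n t /=; rewrite in_itv/= andbT => t0.
    by rewrite lee_fin (le_trans (normr_Im_le _))// Fh.
Qed.

End ComplexIntegral.

(** * Elementary estimates and moments of the exponential *)

Section RealEstimates.
Variable R : realType.
Implicit Types a b c x t : R.

Lemma normr_sin_le x : `|sin x| <= `|x|.
Proof.
wlog x0 : x / 0 < x => [hx|].
  have [x0|x0|->] := ltgtP x 0; last by rewrite sin0.
    by rewrite -normrN -sinN -(normrN x) hx// oppr_gt0.
  exact: hx.
have [|c _] := @MVT _ (@sin R) cos 0 x x0.
  by apply: continuous_subspaceT => y; exact: continuous_sin.
by rewrite sin0 !subr0 => ->; rewrite normrM ler_piMl// cos_max.
Qed.

Lemma normr_cosB1_le x : `|cos x - 1| <= x ^+ 2.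
Proof.
wlog x0 : x / 0 < x => [hx|].
  have [x0|x0|->] := ltgtP x 0; last by rewrite cos0 subrr normr0 expr0n.
    by rewrite -cosN -sqrrN hx// oppr_gt0.
  exact: hx.
have [|c c0x] := @MVT _ (@cos R) (fun y => - sin y) 0 x x0.
  by apply: continuous_subspaceT => y; exact: continuous_cos.
rewrite cos0 !subr0 => -> /=; rewrite normrM normrN (gtr0_norm x0) expr2.
rewrite ler_wpM2r ?(ltW x0)// (le_trans (normr_sin_le _))//.
by move: c0x; rewrite in_itv/= => /andP[/gtr0_norm -> /ltW].
Qed.

Lemma normr_sinB_le x : `|sin x - x| <= x ^+ 2.
Proof.
wlog x0 : x / 0 < x => [hx|].
  have [x0|x0|->] := ltgtP x 0; last by rewrite sin0 subrr normr0 expr0n.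
    by rewrite -normrN opprD -sinN -(sqrrN x) hx// oppr_gt0.
  exact: hx.
have [|c c0x] := @MVT _ (fun y : R => sin y - y) (fun y => cos y - 1) 0 x x0.
  apply: continuous_subspaceT => y; apply: continuousB; first exact: continuous_sin.
  exact: cvg_id.
move: c0x; rewrite in_itv/= => /andP[c0 /ltW cx].
rewrite sin0 !subr0 => -> /=; rewrite normrM (gtr0_norm x0) expr2.
rewrite ler_wpM2r ?(ltW x0)//.
(* The half angle gives a bound linear in c: 1 - cos c = 2 sin(c/2)^2 <= 2 |sin(c/2)| <= c. *)
have c_half : `|sin (c / 2)| <= c / 2.
  by rewrite (le_trans (normr_sin_le _))// ger0_norm// divr_ge0// ltW.
have -> : cos c = 1 - 2 * sin (c / 2) ^+ 2.
  have {1}-> : c = (c / 2) *+ 2 by rewrite -mulr_natr; field.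
  by rewrite cos_mulr2n cos2sin2 mulr2n; ring.
have := sin_max (c / 2); move: c_half; rewrite -[sin _ ^+ 2]real_normK ?num_real//.
move: (normr_ge0 (sin (c / 2))); set s := `|sin _| => s0 sc s1.
by rewrite ler_norml; apply/andP; split; nra.
Qed.

(** The inequality 1 + x <= exp x, taken at a and at -a, brackets exp a - 1 between a and a exp
    a. *)
Lemma normr_expRB1_le a : `|expR a - 1| <= `|a| * expR `|a|.
Proof.
have h1 := expR_ge1Dx a.
have := expR_ge1Dx (- a).
rewrite expRN -(ler_pM2r (expR_gt0 a)) mulVf ?gt_eqF ?expR_gt0//.
move=> h2; have [a0|a0] := leP 0 a.
  by rewrite (ger0_norm a0) ger0_norm; nra.
rewrite (ltr0_norm a0); have : 1 <= expR (- a) by rewrite -expR0 ler_expR; lra.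
have : expR a <= 1 by rewrite -expR0 ler_expR; lra.
by move=> h3 h4; rewrite ler0_norm; nra.
Qed.

Lemma normr_expRB1B_le a : `|expR a - 1 - a| <= a ^+ 2 * expR `|a|.
Proof.
have h1 := expR_ge1Dx a.
have := expR_ge1Dx (- a).
rewrite expRN -(ler_pM2r (expR_gt0 a)) mulVf ?gt_eqF ?expR_gt0//.
move=> h2; rewrite ger0_norm; last lra.
have h3 : expR a - 1 - a <= a * (expR a - 1) by lra.
rewrite (le_trans h3)// (le_trans (ler_norm _))// normrM.
rewrite -[a ^+ 2]real_normK ?num_real// expr2 -mulrA ler_wpM2l//.
exact: normr_expRB1_le.
Qed.

(** This quadratic remainder is what later yields complex derivatives under the integral sign. With
    z = a + i b, the four real pieces are bounded by a^2, b^2, b^2 and |a b| <= a^2 + b^2, each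
    times exp |a|; their sum is at most 3 (a^2 + b^2) exp |a|. *)
Lemma normc_cexpB1B_le (z : R[i]) :
  normc (cexp z - 1 - z) <= 3 * normc z ^+ 2 * expR (normc z).
Proof.
have zE : expR `|complex.Re z| <= expR (normc z) by rewrite ler_expR normr_Re_le.
rewrite (le_trans (normc_le_ReIm _))// normc_sqr.
have h : `|complex.Re z| * `|complex.Im z| <=
    complex.Re z ^+ 2 + complex.Im z ^+ 2.
  rewrite -[complex.Re z ^+ 2]real_normK ?num_real//.
  rewrite -[complex.Im z ^+ 2]real_normK ?num_real//.
  by move: (normr_ge0 (complex.Re z)) (normr_ge0 (complex.Im z)); nra.
rewrite !ReD !ImD !ReN !ImN /cexp ReM ImM /= mul0r subr0 mul0r addr0 oppr0 addr0.
set a := complex.Re z in zE h *; set b := complex.Im z in zE h *.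
have ea : expR a <= expR `|a| by rewrite ler_expR ler_norm.
have -> : expR a * cos b - 1 - a = (expR a - 1 - a) + expR a * (cos b - 1) by ring.
have -> : expR a * sin b - b = expR a * (sin b - b) + (expR a - 1) * b by ring.
have h1 := normr_expRB1B_le a.
have h2 : `|expR a * (cos b - 1)| <= expR `|a| * b ^+ 2.
  by rewrite normrM (gtr0_norm (expR_gt0 _)) ler_pM// ?expR_ge0// normr_cosB1_le.
have h3 : `|expR a * (sin b - b)| <= expR `|a| * b ^+ 2.
  by rewrite normrM (gtr0_norm (expR_gt0 _)) ler_pM// ?expR_ge0// normr_sinB_le.
have h4 : `|(expR a - 1) * b| <= `|a| * expR `|a| * `|b|.
  by rewrite normrM ler_wpM2r// normr_expRB1_le.
have := ler_normD (expR a - 1 - a) (expR a * (cos b - 1)).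
have := ler_normD (expR a * (sin b - b)) ((expR a - 1) * b).
have e0 := expR_gt0 `|a|.
have a20 := sqr_ge0 a.
have b20 := sqr_ge0 b.
have h5 : `|a| * expR `|a| * `|b| <= (a ^+ 2 + b ^+ 2) * expR `|a|.
  by rewrite mulrAC ler_wpM2r// ltW.
have h6 : 3 * (a ^+ 2 + b ^+ 2) * expR `|a| <= 3 * (a ^+ 2 + b ^+ 2) * expR (normc z).
  by rewrite ler_wpM2l// mulr_ge0// addr_ge0.
have h7 : 0 <= expR `|a| * a ^+ 2 by rewrite mulr_ge0// ltW.
lra.
Qed.

Lemma cvgn_series_invsqr K : cvgn (series (fun n => K / n.+1%:R ^+ 2 : R)).
Proof.
have -> : (fun n => K / n.+1%:R ^+ 2) = K *: (fun n => (n.+1%:R ^+ 2)^-1 : R).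
  by apply/funext => n; rewrite /GRing.scale.
apply: is_cvg_seriesZ.
(* For m >= 1 one has 1/m^2 <= 2/(m (m+1)), and the right-hand side is the increment of -2/m. *)
have ch : cvgn (series (telescope (fun n => - 2 * n.+1%:R^-1 : R))).
  rewrite telescopeK; apply: is_cvgB; last exact: is_cvg_cst.
  by apply: is_cvgMr; apply/cvg_ex; exists 0; exact: cvg_harmonic.
have teleE n : telescope (fun n => - 2 * n.+1%:R^-1 : R) n =
    2 / (n.+1%:R * (n.+1%:R + 1)).
  rewrite /telescope/= -[n.+2]addn1 natrD; field.
  by have := ler0n R n => n0; apply/andP; split; rewrite gt_eqF//; lra.
have n1 n : 1 <= n.+1%:R :> R by rewrite ler1n.
apply: series_le_cvg ch => n; rewrite ?invr_ge0 ?sqr_ge0// teleE.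
  by rewrite divr_ge0// mulr_ge0// addr_ge0.
rewrite -subr_ge0.
have -> : 2 / (n.+1%:R * (n.+1%:R + 1)) - (n.+1%:R ^+ 2)^-1 =
    (n.+1%:R - 1) / (n.+1%:R ^+ 2 * (n.+1%:R + 1)) :> R.
  field.
  by have := ler0n R n => n0; apply/andP; split; rewrite gt_eqF//; lra.
by rewrite divr_ge0 ?subr_ge0// mulr_ge0 ?addr_ge0 ?sqr_ge0.
Qed.

Lemma cvg_exprn_expRN c m : 0 < c ->
  t ^+ m * expR (- (c * t)) @[t --> +oo] --> (0 : R).
Proof.
move=> c0.
(* The majorant comes from keeping the term of degree m + 1 in the exponential: exp(c t) >= (c
   t)^(m+1) / (m+1)!. *)
have lim0 : (m.+1`!%:R / c ^+ m.+1) * t^-1 @[t --> +oo] --> (0 : R).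
  rewrite -[X in _ --> X](mulr0 (m.+1`!%:R / c ^+ m.+1)).
  apply: cvgM; first exact: cvg_cst.
  by apply/(gtr0_cvgV0 (f := id)); [exact: nbhs_pinfty_gt|exact: cvg_id].
apply: squeeze_cvgr (cvg_cst 0) lim0; near=> t.
have t0 : 0 < t by near: t; exact: nbhs_pinfty_gt.
rewrite mulr_ge0 ?expR_ge0 ?exprn_ge0 ?(ltW t0)//=.
have := @expR_ge1Dxn _ (c * t) m (mulr_ge0 (ltW c0) (ltW t0)).
rewrite expRN exprMn => h.
have {}h : c ^+ m.+1 * t ^+ m.+1 / m.+1`!%:R <= expR (c * t) by lra.
have f0 : 0 < m.+1`!%:R :> R by rewrite ltr0n fact_gt0.
rewrite ler_pdivrMr ?expR_gt0//.
have -> : t ^+ m = m.+1`!%:R / c ^+ m.+1 * t^-1 *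
    (c ^+ m.+1 * t ^+ m.+1 / m.+1`!%:R).
  rewrite exprS [t ^+ m.+1]exprS; field.
  by rewrite !gt_eqF ?exprn_gt0.
by rewrite ler_wpM2l// !mulr_ge0// ?invr_ge0 ?exprn_ge0 ?ltW.
Unshelve. all: by end_near. Qed.

(** The recursion is integration by parts. The constant of integration makes the primitive vanish at
    infinity, so that the m-th moment is minus its value at 0. *)
Fixpoint moment_primitive c m : R -> R :=
  if m is n.+1 then fun t =>
    - (t ^+ n.+1 * expR (- (c * t)) / c) + n.+1%:R / c * moment_primitive c n t
  else fun t => - (expR (- (c * t)) / c).

Lemma is_derive_expRNM c t :
  is_derive t 1 (fun s => expR (- (c * s))) (- c * expR (- (c * t))).
Proof.
have h : is_derive t 1 (fun s => - c * s) (- c).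
  rewrite [X in is_derive _ _ _ X](_ : _ = - c *: 1); last first.
    by rewrite /GRing.scale/= mulr1.
  exact: (@is_deriveZ _ _ _ id).
rewrite (_ : (fun _ => _) = expR \o (fun s => - c * s)); last first.
  by apply/funext => s /=; rewrite mulNr.
by rewrite mulrC -[- (c * t)]mulNr; exact: is_derive1_comp.
Qed.

Lemma is_derive_moment_primitive c m t : c != 0 ->
  is_derive t 1 (moment_primitive c m) (t ^+ m * expR (- (c * t))).
Proof.
move=> c0; have dE := is_derive_expRNM c t.
elim: m => [|m ih] /=.
  rewrite (_ : (fun _ => _) = - c^-1 \*: (fun s => expR (- (c * s)))); last first.
    by apply/funext => s; rewrite /= /GRing.scale/= mulrC mulNr.
  apply: is_derive_eq; rewrite /GRing.scale/= expr0; field.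
  by [].
have dX : is_derive t 1 (fun s : R => s ^+ m.+1) (m.+1%:R * t ^+ m).
  apply: DeriveDef; first exact: exprn_derivable.
  by rewrite exp_derive /GRing.scale/= mulr1.
rewrite (_ : (fun _ => _) = (- c^-1 \*: ((fun s => s ^+ m.+1) *
  (fun s => expR (- (c * s))))) + (m.+1%:R / c) \*: moment_primitive c m); last first.
  apply/funext => s /=.
  transitivity (- c^-1 * (s ^+ m.+1 * expR (- (c * s))) +
    m.+1%:R / c * moment_primitive c m s) => //.
  by congr (_ + _); rewrite mulrC mulNr.
apply: is_derive_eq; rewrite /GRing.scale/=; field.
by [].
Qed.

Lemma moment_primitive0 c m : c != 0 ->
  moment_primitive c m 0 = - (m`!%:R / c ^+ m.+1).
Proof.
move=> c0; elim: m => [|m ih] /=.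
  by rewrite mulr0 oppr0 expR0 fact0 expr1.
rewrite ih expr0n /= !mul0r oppr0 add0r factS natrM (exprS c m.+1).
by rewrite mulrN invfM mulrACA.
Qed.

Lemma cvg_moment_primitive c m : 0 < c ->
  moment_primitive c m t @[t --> +oo] --> (0 : R).
Proof.
move=> c0.
have hE n := cvg_exprn_expRN n c0.
have hC (f : R -> R) k : f t @[t --> +oo] --> (0 : R) ->
    k * f t @[t --> +oo] --> (0 : R).
  by move=> f0; rewrite -[X in _ --> X](mulr0 k); apply: cvgM => //; exact: cvg_cst.
elim: m => [|m ih] /=.
  have := hC _ (- c^-1) (hE 0%N); apply: cvg_trans; apply: near_eq_cvg.
  by apply: nearW => t /=; ring.
rewrite -[X in _ --> X]addr0; apply: cvgD; last exact: hC.
have := hC _ (- c^-1) (hE m.+1); apply: cvg_trans; apply: near_eq_cvg.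
by apply: nearW => t /=; ring.
Qed.

Local Notation mu := (@lebesgue_measure R).
Local Notation D := (`]0, +oo[%classic : set R).

Lemma continuous_moment c m : continuous (fun t => t ^+ m * expR (- (c * t))).
Proof.
move=> t; apply: cvgM; first exact: exprn_continuous.
suff : {for t, continuous (fun s => expR (- (c * s)))} by [].
apply: differentiable_continuous; apply/derivable1_diffP.
by have [] := is_derive_expRNM c t.
Qed.

Lemma moment_ext c m : 0 < c ->
  (\int[mu]_(t in D) (t ^+ m * expR (- (c * t)))%:E = (m`!%:R / c ^+ m.+1)%:E)%E.
Proof.
move=> c0; have cn0 : c != 0 by rewrite gt_eqF.
rewrite integral_itv_obnd_cbnd; last first.
  apply/measurable_EFinP; apply: measurable_funTS.
  by apply: continuous_measurable_fun; exact: continuous_moment.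
rewrite (@ge0_continuous_FTC2y _ _ (moment_primitive c m) 0 0).
- by rewrite moment_primitive0// sub0e -EFinN opprK.
- by move=> t t0; rewrite mulr_ge0 ?expR_ge0// exprn_ge0.
- by apply: continuous_subspaceT; exact: continuous_moment.
- exact: cvg_moment_primitive.
- by move=> t t0; have [] := @is_derive_moment_primitive c m t cn0.
- apply: cvg_at_right_filter.
  suff : {for 0, continuous (moment_primitive c m)} by [].
  apply: differentiable_continuous; apply/derivable1_diffP.
  by have [] := @is_derive_moment_primitive c m 0 cn0.
- move=> t _; rewrite derive1E.
  by have [_ ->] := @is_derive_moment_primitive c m t cn0.
Qed.

Lemma integrable_moment c m : 0 < c ->
  mu.-integrable D (EFin \o (fun t => t ^+ m * expR (- (c * t)))).
Proof.
move=> c0; apply/integrableP; split.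
  apply/measurable_EFinP; apply: measurable_funTS.
  by apply: continuous_measurable_fun; exact: continuous_moment.
under eq_integral.
  move=> t; rewrite inE /= in_itv /= andbT => t0.
  rewrite ger0_norm ?mulr_ge0 ?expR_ge0 ?exprn_ge0 ?(ltW t0)//.
  over.
by rewrite moment_ext// ltry.
Qed.

Lemma moment c m : 0 < c ->
  \int[mu]_(t in D) (t ^+ m * expR (- (c * t))) = m`!%:R / c ^+ m.+1.
Proof. by move=> c0; rewrite /Rintegral moment_ext. Qed.

End RealEstimates.

(** * The Laplace transform of 1 / (1 - e^(-t) e(beta)) *)

Section BoseFactor.
Variable R : realType.
Variable beta : R.
Hypothesis hbeta : beta \isn't a Num.int.
Local Notation C := (R[i]^o).
Local Notation D := (`]0, +oo[%classic : set R).
Local Notation u := (e2pi beta).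
Implicit Types (z h : R[i]) (t c : R).

(** Here the nonintegrality of beta enters: with y in (0, 1) the fractional part of |beta|, 1 -
    cos(2 pi beta) = 2 sin(pi y)^2 > 0. *)
Lemma cos_2pi_lt1 : cos (2 * pi * beta) < 1.
Proof.
pose b := `|beta|; have b0 : 0 <= b by exact: normr_ge0.
have [n /andP[nb bn]] : exists n : nat, n%:R <= b < n.+1%:R.
  by exists (Num.truncn b); exact: truncn_itv.
pose y := b - n%:R.
have bint : b \isn't a Num.int.
  apply: contra hbeta; rewrite /b; have [_|_] := ger0P beta => //.
  by rewrite rpredN.
have y0 : 0 < y.
  rewrite subr_gt0 lt_neqAle nb andbT; apply: contra bint => /eqP <-.
  by rewrite intr_nat.
have y1 : y < 1 by rewrite ltrBlDl natr1.
have -> : cos (2 * pi * beta) = cos (pi * y *+ 2).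
  rewrite -cos_norm normrM ger0_norm ?mulr_ge0 ?pi_ge0// -/b.
  have -> : 2 * pi * b = pi * y *+ 2 + (pi *+ 2) *+ n.
    rewrite -[X in _ = X + _]mulr_natr -[(_ *+ 2) *+ n]mulr_natr.
    by rewrite -[pi *+ 2]mulr_natr /y; ring.
  by rewrite (periodicn (@cosD2pi R)).
have s0 : 0 < sin (pi * y).
  by apply: sin_gt0_pi; rewrite mulr_gt0 ?pi_gt0//= gtr_pMr ?pi_gt0.
by rewrite cos_mulr2n cos2sin2 -mulr_natr; have := exprn_gt0 2 s0; lra.
Qed.

Definition bose (t : R) : R[i] := 1 / (1 - cexp (- t%:C) * u).

(** The constant 4 serves two ranges of r in |1 - r e(beta)| >= d/4, where d = 1 - cos(2 pi beta)
    lies in (0, 2]. The squared modulus is at least d >= d^2/16 for r >= 1/2, and at least 1/4 >=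
    d^2/16 for r < 1/2. *)
Definition bose_bound : R := 4 / (1 - cos (2 * pi * beta)).

Lemma bose_bound_gt0 : 0 < bose_bound.
Proof. by rewrite divr_gt0// subr_gt0 cos_2pi_lt1. Qed.

(* |1 - r e(beta)|^2 = (1 - r)^2 + 2 r (1 - cos (2 pi beta)). *)
Lemma normc_1Bu_ge (r : R) : 0 <= r <= 1 ->
  bose_bound^-1 <= normc (1 - r%:C * u).
Proof.
move=> /andP[r0 r1]; rewrite invf_div.
rewrite -(ler_pXn2r (_ : 0 < 2)%N) ?nnegrE ?normc_ge0//.
rewrite normc_sqr ReD ImD ReN ImN /e2pi /cexp !ReM !ImM /= expR0 !mul0r !mul1r.
rewrite subr0 !addr0 add0r subr0.
have := cos_2pi_lt1; have := cos_geN1 (2 * pi * beta).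
have := cos2Dsin2 (2 * pi * beta).
set c := cos _; set s := sin _ => cs c1 c2.
have -> : (1 - r * c) ^+ 2 + (- (r * s)) ^+ 2 = (1 - r) ^+ 2 + 2 * r * (1 - c).
  have sE : s ^+ 2 = 1 - c ^+ 2 by rewrite -cs; ring.
  by rewrite sqrrN exprMn sE; ring.
have [rh|rh] := leP (1 / 2) r; nra.
Qed.

Lemma bose_denom_neq0 t : 0 < t -> 1 - cexp (- t%:C) * u != 0.
Proof.
move=> t0; rewrite -rmorphN cexp_real.
have /normc_1Bu_ge : 0 <= expR (- t) <= 1.
  by rewrite expR_ge0 -expR0 ler_expR oppr_le0 ltW.
move=> h; apply/eqP => z0; move: h; rewrite z0 normc0.
by rewrite leNgt invr_gt0 bose_bound_gt0.
Qed.

Lemma normc_bose_le t : 0 < t -> normc (bose t) <= bose_bound.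
Proof.
move=> t0; rewrite /bose mul1r normcV -rmorphN cexp_real.
rewrite -[leRHS]invrK lef_pV2 ?posrE ?invr_gt0 ?bose_bound_gt0//.
  apply: normc_1Bu_ge; rewrite expR_ge0 -expR0 ler_expR oppr_le0 ltW//.
rewrite (lt_le_trans _ (normc_1Bu_ge _)) ?invr_gt0 ?bose_bound_gt0//.
by rewrite expR_ge0 -expR0 ler_expR oppr_le0 ltW.
Qed.

(** The remainder is kept as a multiple of [bose] itself, so that the Laplace transform turns it
    into the same transform at a point shifted by N. *)
Lemma bose_geometric t N : 0 < t ->
  bose t = \sum_(0 <= q < N) (cexp (- t%:C) * u) ^+ q +
    (cexp (- t%:C) * u) ^+ N * bose t.
Proof.
move=> t0; have z0 := bose_denom_neq0 t0.
rewrite /bose; set z := cexp _ * u in z0 *.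
have zN : (1 - z) * \sum_(0 <= q < N) z ^+ q = 1 - z ^+ N.
  by rewrite big_mkord -[1 - z]opprB mulNr -subrX1 opprB.
have z1 : (1 - z) * (1 / (1 - z)) = 1 by rewrite mul1r divff.
by apply: (mulfI z0); rewrite mulrDr zN [in RHS]mulrCA z1 mulr1 subrK.
Qed.

(** Measurability is obtained from the pointwise limit of the geometric partial sums, polynomials in
    an exponential, rather than from the quotient. *)
Lemma cmeasurable_bose : cmeasurable bose.
Proof.
apply: (@cmeasurable_cvg _
  (fun N t => \sum_(0 <= q < N) (cexp (- t%:C) * u) ^+ q)) => [N|t t0].
  apply: cmeasurable_sum => q; apply: cmeasurableX; apply: cmeasurableM.
    rewrite (_ : (fun _ => _) = fun t => cexp (-1 * t%:C)); last first.
      by apply/funext => t; rewrite mulN1r.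
    apply: cmeasurable_cexp; apply: cmeasurableM; last exact: cmeasurable_id.
    exact: cmeasurable_cst.
  exact: cmeasurable_cst.
apply: ccvgP.
have e1 : `|expR (- t)| < 1 by rewrite gtr0_norm ?expR_gt0// expR_lt1 oppr_lt0.
have : expR (- t) ^+ N * bose_bound @[N --> \oo] --> 0 * bose_bound.
  by apply: cvgM; [exact: cvg_expr|exact: cvg_cst].
rewrite mul0r; apply: squeeze_cvgr (cvg_cst 0); apply: nearW => N.
rewrite normc_ge0/= [in leLHS](bose_geometric N t0) opprD addrA subrr sub0r.
rewrite normcN normcM normcX normcM normc_cexp normc_e2pi mulr1 ReN /=.
by rewrite ler_wpM2l ?normc_bose_le// exprn_ge0// expR_ge0.
Qed.

(* The i-th derivative of the Laplace transform of bose. *)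
Definition bose_laplace (i : nat) (z : R[i]) : R[i] :=
  cintegral D (fun t => (- t%:C) ^+ i * cexp (- z * t%:C) * bose t).

Lemma cmeasurable_cexpM z : cmeasurable (fun t => cexp (z * t%:C)).
Proof.
apply: cmeasurable_cexp; apply: cmeasurableM; last exact: cmeasurable_id.
exact: cmeasurable_cst.
Qed.

Lemma cmeasurable_powN i : cmeasurable (fun t : R => (- t%:C) ^+ i).
Proof.
apply: cmeasurableX; rewrite (_ : (fun _ => _) = fun t => -1 * t%:C).
  by apply: cmeasurableM; [exact: cmeasurable_cst|exact: cmeasurable_id].
by apply/funext => t; rewrite mulN1r.
Qed.

Lemma cmeasurable_bose_laplace i z :
  cmeasurable (fun t => (- t%:C) ^+ i * cexp (- z * t%:C) * bose t).
Proof.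
apply: cmeasurableM; last exact: cmeasurable_bose.
by apply: cmeasurableM; [exact: cmeasurable_powN|exact: cmeasurable_cexpM].
Qed.

Lemma normc_powN i t : 0 < t -> normc ((- t%:C) ^+ i) = t ^+ i.
Proof. by move=> t0; rewrite normcX normcN normc_real gtr0_norm. Qed.

Lemma Re_MrealR (z : R[i]) t : complex.Re (z * t%:C) = complex.Re z * t.
Proof. by rewrite ReM /= mulr0 subr0. Qed.

Lemma normc_bose_laplace_integrand_le i c z t : c <= complex.Re z -> 0 < t ->
  normc ((- t%:C) ^+ i * cexp (- z * t%:C) * bose t) <=
  bose_bound * (t ^+ i * expR (- (c * t))).
Proof.
move=> cz t0; rewrite 2!normcM normc_powN// normc_cexp Re_MrealR ReN mulrC.
rewrite ler_pM ?normc_ge0 ?normc_bose_le//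
  ?mulr_ge0 ?expR_ge0 ?exprn_ge0 ?(ltW t0)//.
rewrite ler_wpM2l ?exprn_ge0 ?(ltW t0)// ler_expR mulNr lerN2.
by rewrite ler_wpM2r// ltW.
Qed.

Lemma integrable_Mmoment (K c : R) m : 0 < c ->
  (@lebesgue_measure R).-integrable D
    (EFin \o (fun t => K * (t ^+ m * expR (- (c * t))))).
Proof.
move=> c0; apply: eq_integrable (integrableZl _ K (integrable_moment m c0)) => //.
Qed.

Lemma Mmoment (K c : R) m : 0 < c ->
  \int[@lebesgue_measure R]_(t in D) (K * (t ^+ m * expR (- (c * t)))) =
  K * (m`!%:R / c ^+ m.+1).
Proof. by move=> c0; rewrite RintegralZl ?moment//; exact: integrable_moment. Qed.

Lemma cintegrable_bose_laplace i z : 0 < complex.Re z ->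
  cintegrable (fun t => (- t%:C) ^+ i * cexp (- z * t%:C) * bose t).
Proof.
move=> z0; apply: le_cintegrable (integrable_Mmoment bose_bound i z0).
  exact: cmeasurable_bose_laplace.
by move=> t t0; exact: normc_bose_laplace_integrand_le.
Qed.

Lemma normc_bose_laplace_le i c z : 0 < c -> c <= complex.Re z ->
  normc (bose_laplace i z) <= 2 * bose_bound * i`!%:R / c ^+ i.+1.
Proof.
move=> c0 cz.
rewrite (_ : _ / _ = 2 * (bose_bound * (i`!%:R / c ^+ i.+1))); last first.
  by rewrite !mulrA.
rewrite -Mmoment//; apply: normc_cintegral_le.
- exact: cmeasurable_bose_laplace.
- by move=> t t0; exact: normc_bose_laplace_integrand_le.
- exact: integrable_Mmoment.
Qed.

(** Differentiation under the integral in quantitative form. The remainder has the original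
    integrand multiplied by exp(-h t) - 1 + h t, which is at most 3 |h|^2 t^2 exp(|h| t). Since |h|
    <= c/2, half of the decay exp(-c t) absorbs the growth, leaving the moment of order i + 2 at
    rate c/2; the constant 6 is this 3 times the 2 of [normc_cintegral_le]. *)
Lemma bose_laplace_taylor1 i c z h : 0 < c -> c <= complex.Re z ->
  normc h <= c / 2 ->
  normc (bose_laplace i (z + h) - bose_laplace i z - h * bose_laplace i.+1 z) <=
  6 * bose_bound * i.+2`!%:R / (c / 2) ^+ i.+3 * normc h ^+ 2.
Proof.
move=> c0 cz hc; have c20 : 0 < c / 2 by rewrite divr_gt0.
have z0 : 0 < complex.Re z by exact: lt_le_trans cz.
have zh0 : 0 < complex.Re (z + h).
  rewrite ReD; have := normr_Re_le h; rewrite ler_norml => /andP[h1 _]; lra.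
pose f (t : R) := (- t%:C) ^+ i * cexp (- z * t%:C) * bose t *
  (cexp (- h * t%:C) - 1 - (- h * t%:C)).
have -> : bose_laplace i (z + h) - bose_laplace i z - h * bose_laplace i.+1 z =
    cintegral D f.
  rewrite /bose_laplace -[X in _ - X - _]mul1r -!mulNr.
  have i1 := cintegrable_bose_laplace i zh0.
  have i2 := cintegrableZ (-1) (cintegrable_bose_laplace i z0).
  have i3 := cintegrableZ (- h) (cintegrable_bose_laplace i.+1 z0).
  rewrite -!cintegralZ; [|exact: cintegrable_bose_laplace..].
  rewrite -!cintegralD//; last exact: cintegrableD.
  apply: eq_cintegral => t _; rewrite /f opprD mulrDl cexpD exprS; ring.
have -> : 6 * bose_bound * i.+2`!%:R / (c / 2) ^+ i.+3 * normc h ^+ 2 =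
  2 * (3 * bose_bound * normc h ^+ 2 * (i.+2`!%:R / (c / 2) ^+ i.+3)) by ring.
rewrite -Mmoment//; apply: normc_cintegral_le; last exact: integrable_Mmoment.
- apply: cmeasurableM; first exact: cmeasurable_bose_laplace.
  have -> : (fun t : R => cexp (- h * t%:C) - 1 - (- h * t%:C)) =
      fun t : R => cexp (- h * t%:C) + (-1 + h * t%:C).
    by apply/funext => t; ring.
  apply: cmeasurableD; first exact: cmeasurable_cexpM.
  apply: cmeasurableD; first exact: cmeasurable_cst.
  by apply: cmeasurableM; [exact: cmeasurable_cst|exact: cmeasurable_id].
move=> t t0; rewrite /f normcM.
have := normc_cexpB1B_le (- h * t%:C).
rewrite normcM normcN normc_real (gtr0_norm t0) => h1.
have h2 := normc_bose_laplace_integrand_le i cz t0.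
rewrite (le_trans (ler_pM (normc_ge0 _) (normc_ge0 _) h2 h1))//.
have -> : bose_bound * (t ^+ i * expR (- (c * t))) *
    (3 * (normc h * t) ^+ 2 * expR (normc h * t)) =
  3 * bose_bound * normc h ^+ 2 * (t ^+ i.+2 * expR (- (c * t) + normc h * t)).
  by rewrite expRD !exprS; ring.
rewrite ler_wpM2l//.
  by rewrite mulr_ge0 ?sqr_ge0// mulr_ge0// ltW// bose_bound_gt0.
rewrite ler_wpM2l ?exprn_ge0 ?(ltW t0)// ler_expR.
have : normc h * t <= c / 2 * t by rewrite ler_wpM2r// ltW.
lra.
Qed.

Lemma cintegral_real (h : R -> R) : cintegral D (fun t => (h t)%:C) =
  (\int[@lebesgue_measure R]_(t in D) h t)%:C.
Proof. by rewrite /cintegral /= Rintegral_cst// mul0r. Qed.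

Lemma cexp_bose_factor c q t : cexp (- c%:C * t%:C) * (cexp (- t%:C) * u) ^+ q =
  u ^+ q * (expR (- ((c + q%:R) * t)))%:C.
Proof.
rewrite exprMn -cexpMn mulrA -cexpD [RHS]mulrC -cexp_real; congr (cexp _ * _).
by rewrite rmorphN rmorphM rmorphD /= rmorph_nat; ring.
Qed.

Lemma bose_laplace_shift i c N : 0 < c ->
  bose_laplace i c%:C =
  \sum_(0 <= q < N) u ^+ q * ((-1) ^+ i * i`!%:R / (c + q%:R)%:C ^+ i.+1) +
    u ^+ N * bose_laplace i (c + N%:R)%:C.
Proof.
move=> c0; have cq0 q : 0 < c + q%:R by rewrite ltr_pwDl.
have gi := @cintegrable_bose_laplace i (c + N%:R)%:C (cq0 N).
pose f q (t : R) := (-1) ^+ i * u ^+ q * (t ^+ i * expR (- ((c + q%:R) * t)))%:C.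
have fi q : cintegrable (fun t => (t ^+ i * expR (- ((c + q%:R) * t)))%:C).
  by split; [exact: integrable_moment|exact: integrable0].
have iE q : cintegral D (f q) =
    u ^+ q * ((-1) ^+ i * i`!%:R / (c + q%:R)%:C ^+ i.+1).
  rewrite /f cintegralZ// cintegral_real moment//.
  by rewrite rmorphM/= fmorphV rmorphXn rmorph_nat/=; ring.
under eq_bigr do rewrite -iE.
rewrite -cintegral_sum; last by move=> q; exact: cintegrableZ.
rewrite -cintegralZ//.
rewrite -cintegralD; first last.
- exact: cintegrableZ.
- by apply: cintegrable_sum => q; exact: cintegrableZ.
apply: eq_cintegral => t t0; rewrite {1}(bose_geometric N t0) mulrDr; congr (_ + _).
  rewrite mulr_sumr; apply: eq_bigr => q _; rewrite -mulrA cexp_bose_factor /f.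
  by rewrite [(- t%:C) ^+ i]exprNn rmorphM rmorphXn /=; ring.
rewrite mulrA -[X in X * _]mulrA cexp_bose_factor.
have -> : cexp (- (c + N%:R)%:C * t%:C) = (expR (- ((c + N%:R) * t)))%:C.
  by rewrite -rmorphN -rmorphM cexp_real mulNr.
by ring.
Qed.

(** Convergence and value come together from the exact remainder in [bose_laplace_shift]: its phase
    has modulus 1 and the transform at c + N is O((c + N)^(-i-1)), which tends to 0 even for i =
    0. *)
Lemma bose_laplace_series i c : 0 < c ->
  series (fun q => u ^+ q * ((-1) ^+ i * i`!%:R / (c + q%:R)%:C ^+ i.+1) : C)
    @ \oo --> (bose_laplace i c%:C : C).
Proof.
move=> c0; have cN0 N : 0 < c + N%:R by rewrite ltr_pwDl.
apply: ccvgP.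
have : 2 * bose_bound * i`!%:R * (c + N%:R)^-1 ^+ i.+1 @[N --> \oo] --> (0 : R).
  rewrite -[X in _ --> X](mulr0 (2 * bose_bound * i`!%:R)).
  apply: cvgM; first exact: cvg_cst.
  rewrite -[X in _ --> X](expr0n _ i.+1).
  apply: (@cvg_comp _ _ _ (fun N => (c + N%:R)^-1) (fun x => x ^+ i.+1)); last first.
    exact: exprn_continuous.
  apply/(gtr0_cvgV0 (f := fun N : nat => c + N%:R)); first exact: nearW.
  apply: (@cvg_comp _ _ _ (fun N : nat => N%:R) (fun r => c + r)).
    exact: cvgr_idn.
  exact: cvg_addrl.
apply: squeeze_cvgr (cvg_cst 0); apply: nearW => N; rewrite normc_ge0/=.
rewrite (bose_laplace_shift i N c0) opprD addrA subrr sub0r.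
rewrite normcN normcM normcX normc_e2pi expr1n mul1r exprVn.
exact: normc_bose_laplace_le.
Qed.

End BoseFactor.

(** * Dirichlet series of Laplace transforms and their termwise derivatives *)

Section DirichletLaplace.
Variable R : realType.
Variables alpha beta : R.
Hypothesis hbeta : beta \isn't a Num.int.
Variable s : nat.
Hypothesis hs : (1 < s)%N.
Local Notation C := (R[i]^o).
Local Notation D := (`]0, +oo[%classic : set R).
Local Notation g := (bose_laplace beta).
Local Notation M := (bose_bound beta).
Implicit Types (x h : R[i]) (c t : R) (i p : nat).

Definition lcoef p : R[i] := e2pi alpha ^+ p.+1 / p.+1%:R ^+ s.

Definition dlaplace_term i x p : R[i] :=
  lcoef p * (p.+1%:R ^+ i * g i (p.+1%:R * x)).

(* For s = 2k - 1, the i-th derivative of HZN (2k) alpha beta at x. *)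
Definition dlaplace i x : R[i] := csum (dlaplace_term i x).

Lemma normc_natr n : normc (n%:R : R[i]) = n%:R.
Proof. by rewrite -(rmorph_nat (real_complex R)) normc_real ger0_norm. Qed.

Lemma normc_lcoef p : normc (lcoef p) = (p.+1%:R ^+ s)^-1.
Proof. by rewrite normcM normcX normc_e2pi expr1n mul1r normcV normcX normc_natr. Qed.

Lemma natX_inv_le p m : (1 < m)%N -> (p.+1%:R ^+ m)^-1 <= (p.+1%:R ^+ 2)^-1 :> R.
Proof.
move=> m1; rewrite lef_pV2 ?posrE ?exprn_gt0 ?ltr0n//.
by rewrite ler_weXn2l// ler1n.
Qed.

Lemma Re_natM n x : complex.Re (n%:R * x) = n%:R * complex.Re x.
Proof. by rewrite -(rmorph_nat (real_complex R)) ReM /= mul0r subr0. Qed.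

(** With P = p + 1, the chain-rule factor P^i against (P c)^(-i-1) leaves 1/P for every i. All
    derivatives thus decay like P^(-s-1) and share the majorant 1/P^2 up to a constant. *)
Lemma normc_dlaplace_term_le i c x p : 0 < c -> c <= complex.Re x ->
  normc (dlaplace_term i x p) <= 2 * M * i`!%:R / c ^+ i.+1 / p.+1%:R ^+ 2.
Proof.
move=> c0 cx; have P0 : 0 < p.+1%:R :> R by rewrite ltr0n.
have Pc0 : 0 < p.+1%:R * c by rewrite mulr_gt0.
rewrite /dlaplace_term normcM normc_lcoef normcM normcX normc_natr.
have K0 : 0 <= 2 * M * i`!%:R / c ^+ i.+1.
  rewrite divr_ge0 ?exprn_ge0 ?(ltW c0)// mulr_ge0// mulr_ge0// ltW//.
  exact: bose_bound_gt0.
apply: (@le_trans _ _ (2 * M * i`!%:R / c ^+ i.+1 / p.+1%:R ^+ s.+1)); last first.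
  by rewrite ler_wpM2l// natX_inv_le// ltnW.
have -> : 2 * M * i`!%:R / c ^+ i.+1 / p.+1%:R ^+ s.+1 = (p.+1%:R ^+ s)^-1 *
    (p.+1%:R ^+ i * (2 * M * i`!%:R / (p.+1%:R * c) ^+ i.+1)).
  rewrite exprMn [p.+1%:R ^+ s.+1]exprS [p.+1%:R ^+ i.+1]exprS.
  by field; rewrite !expf_neq0// ?gt_eqF.
rewrite ler_wpM2l ?invr_ge0 ?exprn_ge0// ler_wpM2l ?exprn_ge0//.
by apply: normc_bose_laplace_le => //; rewrite Re_natM ler_wpM2l// ltW.
Qed.

Lemma dlaplace_cvg i x : 0 < complex.Re x ->
  series (dlaplace_term i x : nat -> C) @ \oo --> (dlaplace i x : C).
Proof.
move=> x0.
have h p := normc_dlaplace_term_le i p x0 (lexx _).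
exact: (@csumable R (dlaplace_term i x) _ h (@cvgn_series_invsqr R _)).
Qed.

(** The radius is uniform in P because the condition scales: |P h| <= P c / 2 is the same as |h| <=
    c / 2. The powers scale as well, P^i P^2 P^(-i-3) P^(-s) = P^(-s-1), so the termwise remainders
    sum to a multiple of |h|^2. *)
Lemma dlaplace_taylor1 i x : 0 < complex.Re x -> exists K : R,
  forall h, normc h <= complex.Re x / 2 ->
  normc (dlaplace i (x + h) - dlaplace i x - h * dlaplace i.+1 x) <=
  K * normc h ^+ 2.
Proof.
set c := complex.Re x => c0; have c20 : 0 < c / 2 by rewrite divr_gt0.
pose K0 := 6 * M * i.+2`!%:R / (c / 2) ^+ i.+3.
have K00 : 0 <= K0.
  rewrite divr_ge0 ?exprn_ge0 ?(ltW c20)// mulr_ge0// mulr_ge0// ltW//.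
  exact: bose_bound_gt0.
exists (limn (series (fun p => K0 / p.+1%:R ^+ 2))) => h hc.
have xh0 : 0 < complex.Re (x + h).
  rewrite ReD; have := normr_Re_le h; rewrite ler_norml -/c => /andP[h1 _]; lra.
pose w p := dlaplace_term i (x + h) p - dlaplace_term i x p -
  h * dlaplace_term i.+1 x p.
have wE p : w p = lcoef p * (p.+1%:R ^+ i *
    (g i (p.+1%:R * x + p.+1%:R * h) - g i (p.+1%:R * x) -
     p.+1%:R * h * g i.+1 (p.+1%:R * x))).
  by rewrite /w /dlaplace_term mulrDr exprS; ring.
have wle p : normc (w p) <= K0 * normc h ^+ 2 / p.+1%:R ^+ 2.
  have P0 : 0 < p.+1%:R :> R by rewrite ltr0n.
  have Pc0 : 0 < p.+1%:R * c by rewrite mulr_gt0.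
  rewrite wE normcM normc_lcoef normcM normcX normc_natr.
  apply: (@le_trans _ _ (K0 * normc h ^+ 2 / p.+1%:R ^+ s.+1)); last first.
    have K1 : 0 <= K0 * normc h ^+ 2 by exact: mulr_ge0 K00 (sqr_ge0 _).
    by rewrite ler_wpM2l// natX_inv_le// ltnW.
  have -> : K0 * normc h ^+ 2 / p.+1%:R ^+ s.+1 = (p.+1%:R ^+ s)^-1 *
      (p.+1%:R ^+ i * (6 * M * i.+2`!%:R / (p.+1%:R * c / 2) ^+ i.+3 *
       normc (p.+1%:R * h) ^+ 2)).
    rewrite /K0 normcM normc_natr -[p.+1%:R * c / 2]mulrA !exprMn.
    rewrite [p.+1%:R ^+ s.+1]exprS [p.+1%:R ^+ i.+3]exprS.
    rewrite [p.+1%:R ^+ i.+2]exprS [p.+1%:R ^+ i.+1]exprS -!exprMn.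
    by field; rewrite !expf_neq0// ?gt_eqF.
  rewrite ler_wpM2l ?invr_ge0 ?exprn_ge0// ler_wpM2l ?exprn_ge0//.
  apply: bose_laplace_taylor1 => //; first by rewrite Re_natM.
  by rewrite normcM normc_natr -mulrA ler_wpM2l// ltW.
have -> : dlaplace i (x + h) - dlaplace i x - h * dlaplace i.+1 x = csum w.
  apply/esym/csum_cvg.
  have -> : series (w : nat -> C) = (fun N =>
      series (dlaplace_term i (x + h) : nat -> C) N -
      series (dlaplace_term i x : nat -> C) N -
      (h : C) * series (dlaplace_term i.+1 x : nat -> C) N).
    by apply/funext => N; rewrite /series /= /w !big_split/= !sumrN mulr_sumr.
  apply: cvgB; first by apply: cvgB; exact: dlaplace_cvg.
  by apply: cvgM; [exact: cvg_cst|exact: dlaplace_cvg].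
rewrite (le_trans (normc_csum_le wle (@cvgn_series_invsqr R _)))//.
rewrite le_eqVlt; apply/orP; left; apply/eqP; apply/cvg_lim => //.
rewrite (_ : series (fun p => K0 * normc h ^+ 2 / p.+1%:R ^+ 2) =
    fun N => series (fun p => K0 / p.+1%:R ^+ 2) N * normc h ^+ 2).
  by apply: cvgM; [exact: cvgn_series_invsqr|exact: cvg_cst].
by apply/funext => N; rewrite /series /= mulr_suml; apply: eq_bigr => p _; ring.
Qed.

(** Agreement is assumed on the right half-plane only, which is all that is known of [HZN] and of
    its successive derivatives. It suffices because the derivative is local: |h| <= Re x / 2 keeps x
    + h in the half-plane. *)
Lemma derive1_dlaplace (f : R[i] -> R[i]) i :
  (forall x, 0 < complex.Re x -> f x = dlaplace i x) ->
  forall x, 0 < complex.Re x -> derive1 (f : R[i] -> C) x = dlaplace i.+1 x.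
Proof.
move=> fE x x0; rewrite /derive1; apply: cvg_lim => //; apply: ccvgP.
have [K hK] := dlaplace_taylor1 i x0.
have c20 : 0 < complex.Re x / 2 by rewrite divr_gt0.
have h0 : normc h @[h --> (0 : C)^'] --> (0 : R).
  rewrite (_ : (fun h : C => normc h) = fun h => normc (h - 0)); last first.
    by apply/funext => h; rewrite subr0.
  by apply: (@ccvg_normc _ _ _ _ (fun h : C => h) 0); exact: nbhs_dnbhs.
have Kh0 : K * normc h @[h --> (0 : C)^'] --> (0 : R).
  rewrite -[X in _ --> X](mulr0 K); apply: cvgM => //; exact: cvg_cst.
apply: squeeze_cvgr (cvg_cst 0) Kh0; near=> h; rewrite normc_ge0/=.
have hn0 : h != 0 by near: h; rewrite near_withinE; exact: nearW.
have hc : normc h <= complex.Re x / 2.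
  rewrite -[leLHS]ger0_norm ?normc_ge0//.
  by near: h; move/cvgr0Pnorm_le : h0; apply.
have nh0 : 0 < normc h.
  by rewrite lt_def normc_ge0 andbT; apply: contra hn0 => /eqP/eq0_normc ->.
have xh0 : 0 < complex.Re (h + x).
  rewrite ReD; have := normr_Re_le h; rewrite ler_norml => /andP[h1 _]; lra.
rewrite (fE _ xh0) (fE _ x0) (addrC h).
have -> : h^-1 *: (dlaplace i (x + h) - dlaplace i x : C) - dlaplace i.+1 x =
    h^-1 * (dlaplace i (x + h) - dlaplace i x - h * dlaplace i.+1 x).
  by rewrite [in RHS]mulrBr mulKf.
rewrite normcM normcV ler_pdivrMl// (le_trans (hK _ hc))//.
by rewrite expr2 mulrCA.
Unshelve. all: by end_near. Qed.

Lemma cderiv_dlaplace (f : R[i] -> R[i]) :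
  (forall x, 0 < complex.Re x -> f x = dlaplace 0 x) ->
  forall n x, 0 < complex.Re x -> cderiv n f x = dlaplace n x.
Proof.
move=> fE; elim=> [|n ih] x x0; first exact: fE.
by rewrite -(derive1_dlaplace ih x0).
Qed.

End DirichletLaplace.

(** * The Herglotz-Zagier-Novikov function as such a Dirichlet series *)

Section HZNSeries.
Variable R : realType.
Variables alpha beta : R.
Hypothesis hbeta : beta \isn't a Num.int.
Local Notation C := (R[i]^o).
Local Notation D := (`]0, +oo[%classic : set R).
Local Notation g := (bose_laplace beta).

Lemma HZN_dlaplace k x : (1 < k)%N -> 0 < complex.Re x ->
  HZN k.+1 alpha beta x = dlaplace alpha beta k 0 x.
Proof.
move=> k1 x0.
pose f p (t : R) := lcoef alpha k p * cexp (- (p.+1%:R * x) * t%:C) * bose beta t.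
have fE p : f p = fun t => lcoef alpha k p *
    ((- t%:C) ^+ 0 * cexp (- (p.+1%:R * x) * t%:C) * bose beta t).
  by apply/funext => t; rewrite /f expr0 mul1r -mulrA.
have Px0 p : 0 < complex.Re (p.+1%:R * x).
  by rewrite Re_natM mulr_gt0// ltr0n.
have mf p : cmeasurable (f p).
  rewrite fE; apply: cmeasurableM; first exact: cmeasurable_cst.
  exact: cmeasurable_bose_laplace.
have fi p : cintegrable (f p).
  by rewrite fE; apply: cintegrableZ; exact: (cintegrable_bose_laplace hbeta 0 (Px0 p)).
have ifp p : cintegral D (f p) = dlaplace_term alpha beta k 0 x p.
  rewrite fE cintegralZ; last exact: (cintegrable_bose_laplace hbeta 0 (Px0 p)).
  by rewrite /dlaplace_term [_ ^+ 0 * g _ _]mul1r.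
have fle p t : 0 < t -> normc (f p t) <=
    bose_bound beta * expR (- (complex.Re x * t)) / p.+1%:R ^+ 2.
  move=> t0; rewrite 2!normcM normc_lcoef normc_cexp Re_MrealR ReN Re_natM.
  rewrite [leRHS]mulrC mulrA [leRHS]mulrAC.
  rewrite ler_pM ?normc_ge0 ?normc_bose_le//.
  rewrite ler_pM ?expR_ge0 ?invr_ge0 ?exprn_ge0 ?natX_inv_le//.
  rewrite ler_expR mulNr lerN2 ler_wpM2r ?(ltW t0)// ler_peMl ?(ltW x0)//.
  by rewrite ler1n.
have fsum t : 0 < t -> series (f ^~ t : nat -> C) @ \oo -->
    (polylog (k.+1%:R - 1) (cexp (- x * t%:C) * e2pi alpha) /
      (1 - cexp (- t%:C) * e2pi beta) : C).
  move=> t0; rewrite /polylog -natr1 addrK.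
  pose v p := (cexp (- x * t%:C) * e2pi alpha) ^+ p.+1 / rpowc p.+1%:R k%:R.
  have vE p : f p t = v p * bose beta t.
    rewrite /f /v /lcoef rpowc_nat ?ltr0n// rmorphXn rmorph_nat.
    have -> : cexp (- (p.+1%:R * x) * t%:C) = cexp (- x * t%:C) ^+ p.+1.
      by rewrite -cexpMn; congr cexp; ring.
    by rewrite [in RHS]exprMn; ring.
  have vle p : normc (v p) <= 1 / p.+1%:R ^+ 2.
    rewrite /v normcM normcX normcM normc_e2pi mulr1 normc_cexp normcV.
    rewrite rpowc_nat ?ltr0n// normc_real ger0_norm ?exprn_ge0//.
    rewrite ler_pM ?exprn_ge0 ?expR_ge0 ?invr_ge0 ?natX_inv_le//.
    rewrite exprn_ile1 ?expR_ge0// -expR0 ler_expR Re_MrealR ReN mulNr oppr_le0.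
    by rewrite mulr_ge0// ltW.
  rewrite (_ : series (f ^~ t : nat -> C) =
      fun N => series (v : nat -> C) N * (bose beta t : C)); last first.
    by apply/funext => N; rewrite /series /= mulr_suml; apply: eq_bigr => p _.
  apply: cvgM; last by rewrite /bose div1r; exact: cvg_cst.
  exact: (@csumable R v _ vle (@cvgn_series_invsqr R 1)).
have cF : (fun N => cintegral D (fun t => series (f ^~ t : nat -> C) N) : C)
    @ \oo --> (HZN k.+1 alpha beta x : C).
  (* Since P >= 1, exp(-P Re(x) t) <= exp(-Re(x) t); the sum over P then separates from t, and S
     exp(-Re(x) t) dominates all partial sums. *)
  pose S := limn (series (fun p => bose_bound beta / p.+1%:R ^+ 2)).
  apply: (@cintegral_dominated_cvg R _ _
    (fun t => S * (t ^+ 0 * expR (- (complex.Re x * t))))) => //.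
  - by move=> N; apply: cmeasurable_sum.
  - move=> N t t0; rewrite expr0 mul1r (le_trans (normc_sum _ _ _))//.
    apply: (@le_trans _ _ (series (fun p => bose_bound beta / p.+1%:R ^+ 2) N *
        expR (- (complex.Re x * t)))).
      rewrite /series /= mulr_suml ler_sum// => p _.
      by rewrite mulrAC fle.
    rewrite ler_wpM2r ?expR_ge0// /S.
    apply: nondecreasing_cvgn_le; last exact: cvgn_series_invsqr.
    apply/nondecreasing_series => p _ _.
    by apply: divr_ge0; [exact/ltW/bose_bound_gt0|exact: sqr_ge0].
  - exact: integrable_Mmoment.
have cF' : (fun N => cintegral D (fun t => series (f ^~ t : nat -> C) N) : C)
    @ \oo --> (dlaplace alpha beta k 0 x : C).
  rewrite (_ : (fun N => _) =
      series (dlaplace_term alpha beta k 0 x : nat -> C)); last first.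
    apply/funext => N; rewrite /series /= cintegral_sum//.
    by apply: eq_bigr => p _; rewrite ifp.
  exact: dlaplace_cvg.
by rewrite -(cvg_lim _ cF)// -(cvg_lim _ cF').
Qed.

End HZNSeries.

(** * Partial fractions and the operator D_n *)

Section PartialFractions.
Variable F : fieldType.
Implicit Types u v X Y : F.

(* The difference of consecutive values of this sum is antisymmetric in u and
   v, so that the symmetrised sum does not depend on n. *)
Definition bernstein_half (n : nat) u v : F :=
  u ^+ n.+1 * \sum_(0 <= j < n.+1) 'C(n + j, n)%:R * v ^+ j.

(** By Pascal's rule, multiplication by 1 - v lowers m by one, as for the power series of (1 -
    v)^(-m-2); the last term is the effect of truncation. *)
Lemma binomial_tail_sum m N v :
  (1 - v) * (\sum_(0 <= j < N) 'C(m.+1 + j, m.+1)%:R * v ^+ j) =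
  (\sum_(0 <= j < N) 'C(m + j, m)%:R * v ^+ j) - 'C(m + N, m.+1)%:R * v ^+ N.
Proof.
elim: N => [|N ih].
  by rewrite !big_nil mulr0 addn0 bin_small ?mul0r ?subr0.
rewrite !big_nat_recr//= mulrDr ih addSn addnS binS natrD exprS; ring.
Qed.

(** Two boundary terms survive, with coefficients C(2n+1, n) and -C(2n+2, n+1). The second is -2
    times the first, which produces the factor 1 - 2v = u - v. *)
Lemma bernstein_halfS n u v : u + v = 1 ->
  bernstein_half n.+1 u v - bernstein_half n u v =
  'C((n.*2).+1, n)%:R * (u * v) ^+ n.+1 * (u - v).
Proof.
move=> uv1; have uE : u = 1 - v by rewrite -uv1 addrK.
rewrite /bernstein_half exprSr -mulrA {2}uE binomial_tail_sum.
rewrite big_nat_recr//= addnS addnn.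
have b1 : 'C(n.*2.+1, n.+1) = 'C(n.*2.+1, n).
  by rewrite -addnn -addnS -[in LHS]bin_sub ?leq_addl// addnK addnS.
have -> : (n + n.+2)%N = n.*2.+2 by rewrite !addnS addnn.
rewrite binS b1 natrD -addnn exprMn uE !exprS; ring.
Qed.

(** For probabilities u and v = 1 - u, [bernstein_half n u v] is the chance that n + 1 successes
    come before n + 1 failures, and one of the two must come first. The induction proves this as an
    identity in any field. *)
Lemma bernstein_half_sum n u v : u + v = 1 ->
  bernstein_half n u v + bernstein_half n v u = 1.
Proof.
move=> uv1; have vu1 : v + u = 1 by rewrite addrC.
elim: n => [|n ih].
  by rewrite /bernstein_half !big_nat1 /= addn0 bin0 !mulr1 !expr1.
have h1 := bernstein_halfS n uv1; have h2 := bernstein_halfS n vu1.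
rewrite -[RHS]ih.
rewrite -[bernstein_half n.+1 u v](subrK (bernstein_half n u v)) h1.
rewrite -[bernstein_half n.+1 v u](subrK (bernstein_half n v u)) h2.
by rewrite (mulrC v u); set c := 'C(_, _)%:R * _; ring.
Qed.

Lemma partial_fractions n X Y : X != 0 -> Y != 0 -> Y - X != 0 ->
  \sum_(0 <= i < n.+1) 'C(2 * n - i, n)%:R * (-1) ^+ i * (Y - X) ^+ i *
    (X ^- i.+1 - (-1) ^+ i * Y ^- i.+1) =
  (-1) ^+ n * (Y - X) ^+ (2 * n).+1 / (X * Y) ^+ n.+1.
Proof.
move=> X0 Y0 Z0; set Z := Y - X in Z0 *.
(* With u = Y/Z and v = -X/Z, dividing u^(n+1) v^j by (X Y)^(n+1) cancels Y and leaves the pole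
   X^(-(n-j+1)); the swapped half gives the poles in Y. Setting i = n - j turns C(n+j, n) into
   C(2n-i, n). *)
have uv1 : Y / Z + - (X / Z) = 1 by rewrite -mulrBl divff.
rewrite -[RHS]mulr1 -[U in _ = _ * U](bernstein_half_sum n uv1) /bernstein_half.
rewrite !mulr_sumr -big_split /= mulr_sumr big_nat_rev /= add0n.
apply: eq_big_nat => j /andP[_ jn]; rewrite subSS.
have -> : (2 * n - (n - j))%N = (n + j)%N by rewrite mul2n -addnn; lia.
have nE : n = (n - j + j)%N by rewrite subnK.
set i := (n - j)%N in nE *; rewrite {}nE.
have -> : (2 * (i + j)).+1 = (i + j + i + j).+1 by lia.
rewrite -[- (X / Z)]mulN1r !exprMn !exprVn !exprS !exprD.
have expn_neq0 (x : F) m : x != 0 -> x ^+ m != 0 by exact: expf_neq0.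
have := expn_neq0 _ i X0; have := expn_neq0 _ j X0.
have := expn_neq0 _ i Y0; have := expn_neq0 _ j Y0.
have := expn_neq0 _ i Z0; have := expn_neq0 _ j Z0.
have : ((-1) ^+ j : F) = 1 \/ ((-1) ^+ j : F) = -1.
  by rewrite -signr_odd; case: (odd j); [right|left].
move: (X ^+ i) (X ^+ j) (Y ^+ i) (Y ^+ j) (Z ^+ i) (Z ^+ j).
move: ((-1) ^+ i) ((-1) ^+ j) => ei ej.
move=> xi xj yi yj zi zj; clearbody Z.
by move=> [->|->] zj0 zi0 yj0 yi0 xj0 xi0; field;
  rewrite X0 Y0 Z0 zj0 zi0 yj0 yi0 xj0 xi0.
Qed.

End PartialFractions.

(** * The operator D_n applied to series *)

Section DopLimits.
Variable R : realType.
Local Notation C := (R[i]^o).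

Lemma ccvg_sum (r : seq nat) (F : nat -> nat -> R[i]) (l : nat -> R[i]) :
  (forall i, (F i : nat -> C) @ \oo --> (l i : C)) ->
  (fun N => \sum_(i <- r) F i N : C) @ \oo --> (\sum_(i <- r) l i : C).
Proof.
move=> Fl; elim: r => [|i r ih].
  rewrite (_ : (fun _ => _) = fun=> 0 : C); last first.
    by apply/funext => N; rewrite big_nil.
  by rewrite big_nil; exact: cvg_cst.
rewrite (_ : (fun _ => _) =
    fun N => (F i N : C) + (\sum_(i <- r) F i N : C)); last first.
  by apply/funext => N; rewrite big_cons.
by rewrite big_cons; apply: cvgD; [exact: Fl|exact: ih].
Qed.

(* Dop n f x y, with d for y - x and arbitrary sequences a and b in place of
   the derivatives of f at x and at y. *)
Definition Dop_form (n : nat) (d : R[i]) (a b : nat -> R[i]) : R[i] :=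
  \sum_(0 <= i < n.+1) 'C(2 * n - i, n)%:R *
    ((a i - (-1) ^+ i * b i) / (i`!%:R * d ^+ (n - i))).

(** [Dop_form] is a finite sum, linear in its two sequences, so it commutes with limits of partial
    sums even when convergence is only conditional. *)
Lemma Dop_form_cvg n d (a b : nat -> nat -> R[i]) (la lb : nat -> R[i]) :
  (forall i, series (a i : nat -> C) @ \oo --> (la i : C)) ->
  (forall i, series (b i : nat -> C) @ \oo --> (lb i : C)) ->
  series ((fun q => Dop_form n d (a ^~ q) (b ^~ q)) : nat -> C) @ \oo -->
  (Dop_form n d la lb : C).
Proof.
move=> ha hb; rewrite (_ : series _ = fun N =>
    \sum_(0 <= i < n.+1) 'C(2 * n - i, n)%:R *
      ((series (a i : nat -> C) N - (-1) ^+ i * series (b i : nat -> C) N) /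
        (i`!%:R * d ^+ (n - i))) : C); last first.
  apply/funext => N; rewrite /series /= exchange_big /=; apply: eq_bigr => i _.
  by rewrite -mulr_sumr -mulr_suml big_split /= sumrN mulr_sumr.
apply: (@ccvg_sum _ (fun i N => 'C(2 * n - i, n)%:R *
  ((series (a i : nat -> C) N - (-1) ^+ i * series (b i : nat -> C) N) /
    (i`!%:R * d ^+ (n - i))))) => i.
apply: (@cvgM _ _ _ _ (fun=> _ : C)); first exact: cvg_cst.
apply: (@cvgM _ _ _ _ _ (fun=> _ : C)); last exact: cvg_cst.
apply: cvgB; first exact: ha.
by apply: (@cvgM _ _ _ _ (fun=> _ : C)); [exact: cvg_cst|exact: hb].
Qed.

End DopLimits.

(** * Factorisation of the form and comparison of the two sides *)

Lemma qeval_factor (R : realType) (Q : bqform R) (w w' p q : R) :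
  0 < qyy Q -> qdisc Q = 1 -> w' < w ->
  qeval Q 1 (- w) = 0 -> qeval Q 1 (- w') = 0 ->
  qeval Q p q = (p * w + q) * (p * w' + q) / (w - w').
Proof.
rewrite /qeval /qdisc; case: Q => a b c /= c0 disc ww hw hw'.
have ww0 : w - w' != 0 by rewrite subr_eq0 gt_eqF.
have bE : b = c * (w + w') by apply: (mulfI ww0); lra.
have aE : a = c * w * w' by move: hw; rewrite bE; lra.
(* The discriminant equals (c (w - w'))^2; positivity of c and w' < w select the root 1 over -1. *)
have c1 : c * (w - w') = 1.
  have : (c * (w - w')) ^+ 2 = 1 by rewrite -disc aE bE; ring.
  move=> /eqP; rewrite sqrf_eq1 => /predU1P[//|/eqP cN1].
  have : 0 < c * (w - w') by rewrite mulr_gt0// subr_gt0.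
  by rewrite cN1; lra.
rewrite aE bE (_ : c = (w - w')^-1); last by apply: (mulIf ww0); rewrite c1 mulVf.
by ring.
Qed.

(** The factorials and signs of the derivatives of 1/X and 1/Y reduce [Dop_form] to
    [partial_fractions], where Y - X = P W with W = w' - w. The minus sign in front comes from
    (-1)^n W^(n+1) = -(w - w')^(n+1). *)
Lemma ZQ_term (R : realType) (alpha beta w w' : R) (n p q : nat) :
  0 < w' -> w' < w ->
  e2pi (alpha * p.+1%:R + beta * q%:R) *
    rpowc ((p.+1%:R * w + q%:R) * (p.+1%:R * w' + q%:R) / (w - w')) (- n.+1%:R) =
  - Dop_form n (w'%:C - w%:C)
    (fun i => lcoef alpha (2 * n).+1 p * (p.+1%:R ^+ i *
      (e2pi beta ^+ q *
        ((-1) ^+ i * i`!%:R / (p.+1%:R * w + q%:R)%:C ^+ i.+1))))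
    (fun i => lcoef alpha (2 * n).+1 p * (p.+1%:R ^+ i *
      (e2pi beta ^+ q *
        ((-1) ^+ i * i`!%:R / (p.+1%:R * w' + q%:R)%:C ^+ i.+1)))).
Proof.
move=> w'0 ww; have w0 : 0 < w by exact: lt_trans ww.
have X0 : 0 < p.+1%:R * w + q%:R by rewrite ltr_pwDl// mulr_gt0// ltr0n.
have Y0 : 0 < p.+1%:R * w' + q%:R by rewrite ltr_pwDl// mulr_gt0// ltr0n.
have W0 : 0 < w - w' by rewrite subr_gt0.
rewrite e2piD !e2piMn rpowcN rpowc_nat; last by rewrite !mulr_gt0// invr_gt0.
have toC0 (x : R) : 0 < x -> x%:C != 0.
  by move=> x0; rewrite (inj_eq (@complexI R) x 0) gt_eqF.
have := toC0 _ X0; have := toC0 _ Y0; have := toC0 _ W0.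
have P0 : (p.+1%:R : R[i]) != 0 by rewrite pnatr_eq0.
have -> : (((p.+1%:R * w + q%:R) * (p.+1%:R * w' + q%:R) / (w - w'))
      ^+ n.+1)%:C =
    ((p.+1%:R * w + q%:R)%:C * (p.+1%:R * w' + q%:R)%:C /
      - (w'%:C - w%:C)) ^+ n.+1.
  rewrite rmorphXn rmorphM [_ / _]mulrC fmorphV -rmorphB -rmorphN opprB.
  by rewrite mulrC rmorphM.
have : (p.+1%:R * w' + q%:R)%:C - (p.+1%:R * w + q%:R)%:C =
    p.+1%:R * (w'%:C - w%:C).
  by rewrite !rmorphD !rmorphM /= !rmorph_nat; ring.
set X := (p.+1%:R * w + q%:R)%:C; set Y := (p.+1%:R * w' + q%:R)%:C.
set W := w'%:C - w%:C.
have WE : (w - w')%:C = - W by rewrite rmorphB opprB.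
rewrite WE oppr_eq0 => YX Wn0 Yn0 Xn0.
have Zn0 : Y - X != 0 by rewrite YX mulf_neq0.
(* The chain-rule factor P^i completes the denominator: P^i / W^(n-i) = (P W)^i / W^n = (Y - X)^i /
   W^n, so W^(-n) is common to all i. *)
rewrite [Dop_form n W _ _](_ : _ =
    lcoef alpha (2 * n).+1 p * e2pi beta ^+ q / W ^+ n *
    ((-1) ^+ n * (Y - X) ^+ (2 * n).+1 / (X * Y) ^+ n.+1)); last first.
  rewrite /Dop_form -partial_fractions// mulr_sumr.
  apply: eq_big_nat => i /andP[_ ilen].
  have f0 : (i`!%:R : R[i]) != 0 by rewrite pnatr_eq0 -lt0n fact_gt0.
  have -> : W ^+ n = W ^+ (n - i) * W ^+ i by rewrite -exprD subnK.
  rewrite YX [(p.+1%:R * W) ^+ i]exprMn.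
  have := expf_neq0 (n - i) Wn0; have := expf_neq0 i Wn0.
  have := expf_neq0 i.+1 Xn0; have := expf_neq0 i.+1 Yn0.
  move: (X ^+ i.+1) (Y ^+ i.+1) (W ^+ i) (W ^+ (n - i)) (p.+1%:R ^+ i).
  move: (lcoef _ _ _) (e2pi beta ^+ q) ((-1) ^+ i) => l uq e.
  move=> x y wi wni pi y0 x0 wi0 wni0; field.
  by rewrite y0 x0 wi0 wni0 f0.
rewrite YX /lcoef; move: (e2pi alpha ^+ p.+1) (e2pi beta ^+ q) => ea eb.
rewrite [(p.+1%:R * W) ^+ _]exprMn -mulrA.
have -> : W ^+ (2 * n).+1 = W ^+ n * W ^+ n.+1.
  by rewrite -exprD; congr (_ ^+ _); lia.
rewrite !exprMn exprVn -[- W]mulN1r [(-1 * W) ^+ _]exprMn [(-1) ^+ n.+1]exprS.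
have := expf_neq0 n Wn0; have := expf_neq0 n.+1 Wn0.
have := expf_neq0 n.+1 Xn0; have := expf_neq0 n.+1 Yn0.
have := expf_neq0 (2 * n).+1 P0.
have : ((-1) ^+ n : R[i]) = 1 \/ ((-1) ^+ n : R[i]) = -1.
  by rewrite -signr_odd; case: (odd n); [right|left].
move: (X ^+ _) (Y ^+ _) (W ^+ n) (W ^+ n.+1) (p.+1%:R ^+ _) ((-1) ^+ n).
move=> x y wn wn1 P e [->|->] hP hy hx hw1 hw; field;
  by rewrite hy hx hw hP hw1.
Qed.

Unset Implicit Arguments.

Theorem theorem2p3 (R : realType) (alpha beta : R)
    (hbeta : beta \isn't a Num.int)
    (Q : bqform R)
    (hQxx : 0 < qxx Q) (hQxy : 0 < qxy Q) (hQyy : 0 < qyy Q)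
    (hQindef : indefinite Q) (hQdisc : qdisc Q = 1)
    (w w' : R) (hw'0 : 0 < w') (hw'w : w' < w)
    (hw : qeval Q 1 (- w) = 0) (hw' : qeval Q 1 (- w') = 0)
    (k : nat) (hk : (1 < k)%N) :
  ZQ Q alpha beta k%:R = - Dop k.-1 (HZN (2 * k) alpha beta) w%:C w'%:C.
Proof.
case: k hk => [//|n] n0; rewrite -[n.+1.-1]/n.
(* With k = n + 1, the weight exponent s = 2k - 1 is 2n + 1. *)
have s1 : (1 < (2 * n).+1)%N by lia.
have w0 : 0 < w by exact: lt_trans hw'w.
have kE : (2 * n.+1 = (2 * n).+2)%N by lia.
have FE (x : R[i]) : 0 < complex.Re x ->
    HZN (2 * n.+1) alpha beta x = dlaplace alpha beta (2 * n).+1 0 x.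
  by move=> x0; rewrite kE HZN_dlaplace.
have dE := cderiv_dlaplace hbeta s1 FE.
pose a v p i := dlaplace_term alpha beta (2 * n).+1 i v%:C p.
pose d := w'%:C - w%:C.
have -> : Dop n (HZN (2 * n.+1) alpha beta) w%:C w'%:C = Dop_form n d
    (fun i => dlaplace alpha beta (2 * n).+1 i w%:C)
    (fun i => dlaplace alpha beta (2 * n).+1 i w'%:C).
  by apply: eq_bigr => i _; rewrite !dE.
(* At fixed p the operator acts on the two series in q at P w and P w', whose sums are the p-th
   terms of the Dirichlet series; the sum over p is taken only afterwards. *)
have inner p : csum (fun q => e2pi (alpha * p.+1%:R + beta * q%:R) *
    rpowc (qeval Q p.+1%:R q%:R) (- n.+1%:R)) = - Dop_form n d (a w p) (a w' p).
  pose T v i q := lcoef alpha (2 * n).+1 p * (p.+1%:R ^+ i *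
    (e2pi beta ^+ q * ((-1) ^+ i * i`!%:R / (p.+1%:R * v + q%:R)%:C ^+ i.+1))).
  have Tcvg v i : 0 < v -> series (T v i : nat -> R[i]^o) @ \oo -->
      (a v p i : R[i]^o).
    move=> v0; have Pv0 : 0 < p.+1%:R * v by rewrite mulr_gt0// ltr0n.
    have := @bose_laplace_series _ _ hbeta i _ Pv0; rewrite rmorphM rmorph_nat => h.
    rewrite (_ : series _ = fun N => (lcoef alpha (2 * n).+1 p : R[i]^o) *
      ((p.+1%:R ^+ i : R[i]^o) * series (fun q => e2pi beta ^+ q *
        ((-1) ^+ i * i`!%:R / (p.+1%:R * v + q%:R)%:C ^+ i.+1) : R[i]^o) N)).
      apply: cvgM; first exact: cvg_cst.
      by apply: cvgM; [exact: cvg_cst|exact: h].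
    by apply/funext => N; rewrite /series /= -!mulr_sumr.
  apply: csum_cvg.
  rewrite (_ : series _ = fun N => - series ((fun q =>
      Dop_form n d (T w ^~ q) (T w' ^~ q)) : nat -> R[i]^o) N).
    by apply: cvgN; apply: Dop_form_cvg => i; exact: Tcvg.
  apply/funext => N; rewrite /series /= -sumrN.
  apply: eq_bigr => q _.
  by rewrite (qeval_factor _ _ hQyy hQdisc hw'w hw hw') ZQ_term.
rewrite /ZQ; under eq_fun do rewrite inner.
apply: csum_cvg.
have ha v i : 0 < v -> series (fun p => a v p i : R[i]^o) @ \oo -->
    (dlaplace alpha beta (2 * n).+1 i v%:C : R[i]^o).
  by move=> v0; exact: dlaplace_cvg.
rewrite (_ : series _ = fun N => - series ((fun p =>
    Dop_form n d (a w p) (a w' p)) : nat -> R[i]^o) N).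
  apply: cvgN; apply: (@Dop_form_cvg _ _ _ (fun i p => a w p i)
    (fun i p => a w' p i)) => i; exact: ha.
by apply/funext => N; rewrite /series /= sumrN.
Qed.
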